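(* Let $\mathcal{M}$ be an $n$-manifold topologically equivalent to an $n$-manifold $\mathcal{N}$, let $\mu$ and $\nu$ be the measures defined on $\mathcal{M}$ and $\mathcal{N}$, and let $\rho_\mu$ and $\rho_\nu$ be the corresponding densities. For the $n$-dimensional volumetric stretch energy $$E_V(f)=\int_{\mathcal{M}}\Big[\frac{\rho_\nu\circ f}{\rho_\mu}\,\mathrm{Det}(\nabla_{\mathcal{M}}f)\Big]^2\,d\mu,$$ let $$S_f=\{E_V(f)\mid f:\mathcal{M}\to\mathcal{N}\text{ is an orientation preserving and bijective } C^1 \text{ map with } f(\partial\mathcal{M})=\partial\mathcal{N}\}.$$ Then: (i) $\min S_f\ge \frac{\nu(\mathcal{N})^2}{\mu(\mathcal{M})}$; (ii) an admissible map $f^*$ (an orientation preserving bijective $C^1$ map $f^*:\mathcal{M}\to\mathcal{N}$ with $f^*(\partial\mathcal{M})=\partial\mathcal{N}$) is a minimizer with $E_V(f^* )=\min S_f=\frac{\nu(\mathcal{N})^2}{\mu(\mathcal{M})}$ if and only if $f^*$ is mass-preserving.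
   Context: Setting: $\mathcal{M}=\{\mathbf{x}=h(\mathbf{u}):\mathbf{u}=(u_1,\dots,u_n)\in\Omega\subseteq\mathbb{R}^n\}$ is a smooth $n$-manifold topologically equivalent to the $n$-dimensional unit ball $\mathbb{B}^n$, where the Jacobian matrix $J_h$ of $h$ has full column rank ($\det(J_h^\top J_h)\ne0$); $\mathcal{N}$ is another $n$-manifold topologically equivalent to $\mathcal{M}$. The measures have densities with respect to the volume element $d\sigma$: $\mu(B)=\int_B d\mu=\int_B\rho_\mu\,d\sigma$ for subregions $B\subset\mathcal{M}$, and similarly $\nu$ has density $\rho_\nu$ on $\mathcal{N}$; the densities satisfy $0<L\le\rho_\mu,\rho_\nu<+\infty$ for a constant $L$. The tangential gradient of $f$ on $\mathcal{M}$ is $\nabla_{\mathcal{M}}f=J_{f\circ h}J_h^{\dagger}$, where $J_{f\circ h}$ is the Jacobian matrix of $f\circ h$ and $\dagger$ denotes the Moore–Penrose inverse. $\mathrm{Det}(\cdot)$ is the pseudo-determinant, i.e. the product of all nonzero eigenvalues of the matrix. An orientation preserving bijective $C^1$ map $f:\mathcal{M}\to\mathcal{N}$ is mass-preserving if $\frac{\nu(A)}{\nu(f(\mathcal{M}))}=\frac{\mu(f^{-1}(A))}{\mu(\mathcal{M})}$ for every subregion $A\subset f(\mathcal{M})$.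
   Formalization: Det is taken as the product of the nonzero singular values of the tangential gradient, not of its nonzero eigenvalues; with eigenvalues the claim fails (a flat disc tilted isometrically in 3-space) or is undefined (non-square matrix). The squares agree for flat full-dimensional domains. *)

(* Defs.v *)
From HB Require Import structures.
From mathcomp Require Import all_boot all_order all_algebra.
From mathcomp Require Import complex.
From mathcomp Require Import all_classical all_reals all_analysis.

Set Implicit Arguments.
Unset Strict Implicit.
Unset Printing Implicit Defensive.
Import Order.TTheory GRing.Theory Num.Theory.
Import numFieldNormedType.Exports.

Local Open Scope classical_set_scope.
Local Open Scope ring_scope.

Section row_vector_measurable.
Context {R : realType} {n : nat}.

Definition rV_coord (i : 'I_n) (x : 'rV[R]_n) : measurableTypeR R := x 0 i.

Let rV_set0 : g_sigma_preimage rV_coord set0.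
Proof. exact: sigma_algebra0. Qed.

Let rV_setC A : g_sigma_preimage rV_coord A -> g_sigma_preimage rV_coord (~` A).
Proof. exact: sigma_algebraC. Qed.

Let rV_bigcup (F : (set 'rV[R]_n)^nat) :
  (forall i, g_sigma_preimage rV_coord (F i)) ->
  g_sigma_preimage rV_coord (\bigcup_i (F i)).
Proof. exact: sigma_algebra_bigcup. Qed.

(* The product sigma-algebra, i.e. the Borel sets of R^n. *)
HB.instance Definition _ := @isMeasurable.Build
  (measure_tuple_display default_measure_display) ('rV[R]_n)
  (g_sigma_preimage rV_coord) rV_set0 rV_setC rV_bigcup.

Lemma measurable_rV_coord (i : 'I_n) : measurable_fun setT (rV_coord i).
Proof.
move=> _ Y mY; rewrite setTI; apply: sub_sigma_algebra => /=.
rewrite -bigcup_seq/=; exists i => /=; first by rewrite mem_index_enum.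
by exists Y => //; rewrite setTI.
Qed.

Lemma measurable_fun_rVP d (T : measurableType d) (f : T -> 'rV[R]_n) :
  (forall i, measurable_fun setT (rV_coord i \o f)) -> measurable_fun setT f.
Proof.
move=> mf; suff : g_sigma_preimage (fun i => rV_coord i \o f) `<=` measurable.
  by rewrite g_sigma_preimage_comp => prefS _ A mA; apply: prefS; exists A.
apply: smallest_sub; first exact: sigma_algebra_measurable.
move=> A; rewrite -bigcup_seq => -[i _ [B mB <-]]; exact: mf.
Qed.

End row_vector_measurable.

Section lebesgue_row_vector.
Context {R : realType}.

Definition rV_snoc n (p : 'rV[R]_n * measurableTypeR R) : 'rV[R]_n.+1 :=
  \row_i (if unlift ord_max i is Some j then p.1 0 j else p.2).

Lemma measurable_rV_snoc n : measurable_fun setT (@rV_snoc n).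
Proof.
apply: measurable_fun_rVP => i; rewrite /rV_coord /comp.
under eq_fun do rewrite mxE.
case: (unlift ord_max i) => [j|]; last exact: measurable_snd.
exact: (measurableT_comp (measurable_rV_coord j) measurable_fst).
Qed.

(* Lebesgue measure on R^n as an n-fold product of the Lebesgue measure on R:
   the successor case pushes the product measure forward to row vectors. *)
Fixpoint lebesgue_rV n : {measure set 'rV[R]_n -> \bar R} :=
  match n with
  | 0 => \d_(0 : 'rV[R]_0)
  | n'.+1 => measure_function_pushforward__canonical__measure_function_Measure
      (lebesgue_rV n' \x @lebesgue_measure R)%E (@measurable_rV_snoc n')
  end.

End lebesgue_row_vector.

Section topology.

Definition homeomorphism {S T : topologicalType} (A : set S) (B : set T)
    (g : S -> T) : Prop :=
  [/\ set_bij A B g, {within A, continuous g} &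
      exists2 g' : T -> S, {within B, continuous g'} &
        forall x, A x -> g' (g x) = x].

Definition homeomorphic {S T : topologicalType} (A : set S) (B : set T) :=
  exists g : S -> T, homeomorphism A B g.

(* The Euclidean ball; the norm of 'rV[R]_n is the sup norm. *)
Definition unit_ball (R : realType) n : set 'rV[R]_n :=
  [set x | \sum_(i < n) x 0 i ^+ 2 <= 1].

End topology.

Section differentiability.
Context {R : realType}.

Fixpoint is_Ck n m (k : nat) (U : set 'rV[R]_n)
    (F : 'rV[R]_n -> 'rV[R]_m) : Prop :=
  match k with
  | 0 => forall u, U u -> {for u, continuous F}
  | k'.+1 => (forall u, U u -> differentiable F u) /\
             (forall v, is_Ck k' U (fun u => 'D_v F u))
  end.

(* Regularity on a set that need not be open: F itself is regular on an open
   neighborhood, so that its Jacobian makes sense at every point of A. *)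
Definition C1_on n m (A : set 'rV[R]_n) (F : 'rV[R]_n -> 'rV[R]_m) : Prop :=
  exists U, [/\ open U, A `<=` U & is_Ck 1 U F].

Definition smooth_on n m (A : set 'rV[R]_n) (F : 'rV[R]_n -> 'rV[R]_m) : Prop :=
  exists U, [/\ open U, A `<=` U & forall k, is_Ck k U F].

(* The library's 'J acts on row vectors on the right; the usual m x n Jacobian
   matrix is its transpose. *)
Definition jac n m (F : 'rV[R]_n -> 'rV[R]_m) (u : 'rV[R]_n) : 'M[R]_(m, n) :=
  ('J F u)^T.

End differentiability.

Section matrices.
Context {R : realType}.

(* Moore-Penrose inverse, singled out by the four Penrose equations (pinvmx is
   only some generalized inverse). *)
Definition mp_inverse m n (A : 'M[R]_(m, n)) : 'M[R]_(n, m) :=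
  xget 0 [set X | [/\ A *m X *m A = A, X *m A *m X = X,
                      (A *m X)^T = A *m X & (X *m A)^T = X *m A]].

(* Complex eigenvalues, listed with algebraic multiplicity. *)
Definition eigenvalues n (A : 'M[R]_n) : seq R[i] :=
  sval (closed_field_poly_normal (char_poly (map_mx (real_complex R) A))).

Definition pseudo_det n (A : 'M[R]_n) : R[i] :=
  \prod_(z <- eigenvalues A | z != 0) z.

(* The pseudo-determinant of a matrix that is not symmetric, possibly not even
   square: product of the nonzero eigenvalues of |A| = (A^T A)^(1/2). *)
Definition Det p m (A : 'M[R]_(p, m)) : R :=
  Num.sqrt (complex.Re (pseudo_det (A^T *m A))).

Lemma pseudo_det_unitmx n (A : 'M[R]_n) :
  A \in unitmx -> pseudo_det A = real_complex R (\det A).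
Proof.
move=> Aunit; rewrite /pseudo_det /eigenvalues.
case: closed_field_poly_normal => r /=.
set B := map_mx _ A; rewrite (monicP (char_poly_monic B)) scale1r => rE.
have sr : size r = n.
  by apply: succn_inj; rewrite -(size_prod_XsubC r id) -rE size_char_poly.
have prE : \prod_(z <- r) z = \det B.
  have := char_poly_det B; rewrite -horner_coef0 rE horner_prod.
  under eq_bigr do rewrite hornerXsubC sub0r -mulN1r.
  rewrite big_split/= big_const_seq count_predT sr iter_mulr_1.
  by apply: mulfI; rewrite expf_neq0// oppr_eq0 oner_eq0.
rewrite -det_map_mx -/B -prE big_mkcond/=; apply: eq_big_seq => z zr.
case: eqVneq => //= z0; exfalso; move: Aunit; rewrite unitmxE unitfE.
suff : \det B = 0 by rewrite det_map_mx => /eqP; rewrite fmorph_eq0 => ->.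
by rewrite -prE; apply/eqP; rewrite prodf_seq_eq0; apply/hasP; exists z;
  rewrite // z0 eqxx.
Qed.

(* For an invertible square matrix, [Det] and the product of the eigenvalues
   agree up to sign. *)
Lemma Det_unitmx n (A : 'M[R]_n) :
  A \in unitmx -> real_complex R (Det A) ^+ 2 = pseudo_det A ^+ 2.
Proof.
move=> uA; rewrite /Det !pseudo_det_unitmx ?unitmx_mul ?unitmx_tr ?uA//=.
by rewrite det_mulmx det_tr -expr2 -!rmorphXn/= sqr_sqrtr// sqr_ge0.
Qed.

End matrices.

(* An n-manifold of R^m, possibly with boundary, given by one global smooth
   parametrization of full column rank; it is oriented by that
   parametrization. *)
Structure manifold (R : realType) (n m : nat) := Manifold {
  mdom : set 'rV[R]_n;
  mpar : 'rV[R]_n -> 'rV[R]_m;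
  mpar_smooth : smooth_on mdom mpar;
  mpar_homeo : homeomorphism mdom (mpar @` mdom) mpar;
  mpar_full_rank :
    forall u, mdom u -> \det ((jac mpar u)^T *m jac mpar u) != 0 }.

Definition mcarrier (R : realType) n m (M : manifold R n m) : set 'rV[R]_m :=
  mpar M @` mdom M.
Coercion mcarrier : manifold >-> set.

Section manifold_theory.
Context {R : realType} {n m : nat} (M : manifold R n m).

(* By invariance of domain this is the manifold boundary of M as soon as M is
   homeomorphic to the closed ball. *)
Definition mboundary : set 'rV[R]_m := mpar M @` (mdom M `\` (mdom M)°).

Definition mcoord (x : 'rV[R]_m) : 'rV[R]_n :=
  xget 0 [set u | mdom M u /\ mpar M u = x].

(* Integral of g over B with respect to the volume element dsigma of M, which
   is (det (J_h^T J_h))^(1/2) du in the parametrization h. *)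
Definition vol_integral (B : set 'rV[R]_m) (g : 'rV[R]_m -> R) : \bar R :=
  (\int[lebesgue_rV n]_(u in mdom M `&` mpar M @^-1` B)
    (g (mpar M u) *
     Num.sqrt (\det ((jac (mpar M) u)^T *m jac (mpar M) u)))%:E)%E.

Definition density_measure (rho : 'rV[R]_m -> R) (B : set 'rV[R]_m) : \bar R :=
  vol_integral B rho.

Definition tgrad p (f : 'rV[R]_m -> 'rV[R]_p) (x : 'rV[R]_m) : 'M[R]_(p, m) :=
  jac (f \o mpar M) (mcoord x) *m mp_inverse (jac (mpar M) (mcoord x)).

End manifold_theory.

Section stretch_energy.
Context {R : realType} {n m p : nat}.
Variables (M : manifold R n m) (N : manifold R n p).
Implicit Type f : 'rV[R]_m -> 'rV[R]_p.

(* The differential of f maps the oriented frame of M to an oriented frame of N: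
   G is the Jacobian matrix of f in the two parametrizations. *)
Definition orientation_preserving f : Prop :=
  forall u v, mdom M u -> mdom N v -> mpar N v = f (mpar M u) ->
    exists2 G : 'M[R]_n, 0 < \det G &
      jac (f \o mpar M) u = jac (mpar N) v *m G.

Definition admissible f : Prop :=
  [/\ C1_on M f, set_bij M N f, orientation_preserving f &
      f @` mboundary M = mboundary N].

Variables (rho_mu : 'rV[R]_m -> R) (rho_nu : 'rV[R]_p -> R).
Let mu := density_measure M rho_mu.
Let nu := density_measure N rho_nu.

(* The last factor is the density in d mu = rho_mu d sigma. *)
Definition stretch_energy f : \bar R :=
  vol_integral M M (fun x =>
    (rho_nu (f x) / rho_mu x * Det (tgrad M f x)) ^+ 2 * rho_mu x).

Definition energy_set : set (\bar R) := stretch_energy @` [set f | admissible f].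

Definition mass_preserving f : Prop :=
  forall A, measurable A -> A `<=` f @` M ->
    (nu A / nu (f @` M) = mu (M `&` f @^-1` A) / mu M)%E.

End stretch_energy.

Definition is_min {R : realType} (S : set (\bar R)) (e : \bar R) : Prop :=
  S e /\ lbound S e.

(* Main.v *)
(* In the parametrizations h of M and k of N, an admissible f becomes the chart
   map phi = k^-1 o f o h between the compact sets U = mdom M and V = mdom N.
   It satisfies J(f o h) = (J k o phi) G with det G > 0, and
   Det(grad f) = det G sqrt(det gram_k o phi) / sqrt(det gram_h). With
   w = rho_mu sqrt(det gram_h) and
   t = (rho_nu o k o phi) sqrt(det gram_k o phi) det G this gives
   E(f) = int_U t^2/w and mu(M) = int_U w, while nu(N) = int_U t by the change
   of variables formula for phi. For c = nu(N)/mu(M) one has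
   t^2/w = (t - c w)^2/w + 2 c t - c^2 w, so E(f) - nu(N)^2/mu(M) is the
   integral of (t - c w)^2/w: it is nonnegative, and it vanishes iff t = c w
   almost everywhere, i.e. iff f preserves mass.

   U need not be open, so the change of variables is proved for injective maps
   of a compact set that are strictly differentiable relative to that set. Near
   each point such a map is a linear map composed with a map that distorts
   sup-norm distances by a factor close to 1, and a c-Lipschitz map for the sup
   norm multiplies the measure of a compact set by at most c^n, because it maps
   the pieces of a fine grid of cubes into cubes. *)

From HB Require Import structures.
Require Import Defs.
From mathcomp Require Import all_boot all_order all_algebra all_fingroup.
From mathcomp Require Import complex.
From mathcomp Require Import all_classical all_reals all_analysis.
From mathcomp Require Import measurable_realfun ring lra zify.
Set Implicit Arguments.
Unset Strict Implicit.
Unset Printing Implicit Defensive.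
Import Order.TTheory GRing.Theory Num.Theory.
Import numFieldNormedType.Exports.
Local Open Scope classical_set_scope.
Local Open Scope ring_scope.

(** * Borel sets of the space of row vectors *)

(** Strict differentiability relative to a set is the notion that survives: f o h gets it from an
    open neighborhood by the mean value inequality, and it lifts through k because a Jacobian of
    full rank has a one-sided inverse. It controls distances in both directions, so the lower bound
    on the measure of an image is the Lipschitz bound for the inverse map.

    The Lipschitz bound concerns compact sets because the grid cells that meet K only fill a
    neighborhood of K, whose measure must tend to that of K. The sup norm loses no dimensional
    constant, its balls being cubes; in exchange, linear maps need their own argument, by LUP
    factorization.

    Positivity of mu(M) would call for invariance of domain. The case mu(M) = 0 is absorbed instead
    by the conventions for division in the extended reals: the energy, nu(N) and the quotient are
    then all 0. *)

Section row_vector_norm.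
Context {R : realType} {n : nat}.
Implicit Types (x y : 'rV[R]_n) (r : R).

Lemma ler_rV_norm x r : 0 <= r -> (`|x| <= r) = [forall i, `|x 0 i| <= r].
Proof.
move=> r0; rewrite -[`|x|]/(mx_norm x) mx_normrE; apply/idP/forallP => [xr i|xr].
  apply: le_trans xr; apply: (@le_trans _ _ (`|x (0, i).1 (0, i).2|)) => //.
  exact: (le_bigmax _ (fun ij : 'I_1 * 'I_n => `|x ij.1 ij.2|) (0, i)).
by apply/bigmax_leP; split => // -[i j] _ /=; rewrite ord1.
Qed.

Lemma rV_coord_le_norm x i : `|x 0 i| <= `|x|.
Proof. by have := lexx `|x|; rewrite {1}ler_rV_norm// => /forallP/(_ i). Qed.

(** The conjunct [0 < r] carries the case n = 0, where the condition on the coordinates is empty. *)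
Lemma rV_ball x r y : ball x r y <-> 0 < r /\ forall i, `|x 0 i - y 0 i| < r.
Proof.
split=> [[r0 h]|[r0 h]]; first by split=> // i; exact: (h 0 i).
by split=> // i j; rewrite ord1; exact: h.
Qed.

Lemma measurable_rV_ball x r : measurable (ball x r).
Proof.
have [r0|r0] := ltP 0 r; last first.
  rewrite (_ : ball x r = set0)//; apply/seteqP; split => // y /rV_ball[].
  by rewrite ltNge r0.
rewrite (_ : ball x r =
  \bigcap_(i in [set` 'I_n]) (@rV_coord R n i @^-1` ball (x 0 i) r)).
  apply: fin_bigcap_measurable; first exact: finite_finset.
  move=> i _; rewrite -[X in measurable X]setTI.
  apply: measurable_rV_coord => //; apply: open_measurable; exact: ball_open.
apply/seteqP; split => [y /rV_ball[_ h] i _|y h]; first exact: h.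
by apply/rV_ball; split=> // i; exact: h.
Qed.

Lemma rat_approx x r : 0 < r -> exists q : 'rV[rat]_n, ball x r (map_mx (@ratr R) q).
Proof.
move=> r0.
have h (i : 'I_n) : {q : rat | ball (x 0 i) r (ratr q)}.
  apply: cid; have := @dense_rat R (ball (x 0 i) r).
  move=> /(_ _ _)[]; [by exists (x 0 i); exact: ballxx|exact: ball_open|].
  by move=> y [xq [q _ qy]]; exists q; rewrite qy.
exists (\row_i sval (h i)); apply/rV_ball; split=> // i.
by rewrite !mxE; exact: (svalP (h i)).
Qed.

Lemma open_measurable_rV (A : set 'rV[R]_n) : open A -> measurable A.
Proof.
move=> oA.
(* Balls with rational center and radius 1/(k+1) that lie inside A; the others become empty, so that
   all pairs can index a countable union. *)
pose F (p : 'rV[rat]_n * nat) : set 'rV[R]_n :=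
  [set y : 'rV[R]_n | ball (map_mx (@ratr R) p.1) p.2.+1%:R^-1 y /\
           ball (map_mx (@ratr R) p.1) p.2.+1%:R^-1 `<=` A].
have mF p : measurable (F p).
  have [h|h] := pselect (ball (map_mx (@ratr R) p.1) p.2.+1%:R^-1 `<=` A).
    rewrite (_ : F p = ball (map_mx (@ratr R) p.1) p.2.+1%:R^-1).
      exact: measurable_rV_ball.
    by apply/seteqP; split=> [y []|y yb].
  by rewrite (_ : F p = set0)//; apply/seteqP; split=> [y []|y []].
rewrite (_ : A = \bigcup_p F p).
  by apply: countable_bigcupT_measurable => //; exact: countableP.
apply/seteqP; split=> [x Ax|x [p _ [xp]]]; last exact.
move: oA; rewrite openE => /(_ _ Ax)/nbhs_ballP[e /= e0 eA].
(* A radius below e / 2, because x is that close to q and y is that close to q. *)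
have [k _ /(_ k (leqnn k)) ke] := near_infty_natSinv_lt (PosNum (divr_gt0 e0 (ltr0Sn R 1))).
rewrite /= in ke.
have [q xq] := @rat_approx x k.+1%:R^-1 ltac:(by rewrite invr_gt0 ltr0n).
exists (q, k) => //; split=> /=; first exact: ball_sym.
move=> y qy; apply: eA; apply: (@ball_splitl _ _ (map_mx (@ratr R) q)).
  by apply: le_ball xq; exact: ltW.
by apply: ball_sym; apply: le_ball qy; exact: ltW.
Qed.

Lemma closed_measurable_rV (A : set 'rV[R]_n) : closed A -> measurable A.
Proof.
by rewrite -openC => /open_measurable_rV/measurableC; rewrite setCK.
Qed.

Lemma compact_measurable_rV (A : set 'rV[R]_n) : compact A -> measurable A.
Proof.
by move=> /(compact_closed (@norm_hausdorff _ _))/closed_measurable_rV.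
Qed.

(** Closed sets are a generating family stable under intersection: maps continuous on closed sets
    are measurable by testing on them, and finite measures that agree on them are equal. *)
Lemma measurable_rVE :
  @measurable _ 'rV[R]_n = <<s [set A : set 'rV[R]_n | closed A] >>.
Proof.
apply/seteqP; split; last first.
  by apply: smallest_sub => //; [exact: sigma_algebra_measurable|exact: closed_measurable_rV].
apply: smallest_sub; first exact: smallest_sigma_algebra.
move=> A; rewrite -bigcup_seq/= => -[i _ [B mB <-]]; rewrite setTI.
(* The same space with the sigma-algebra generated by the closed sets; the coordinates, being
   continuous, are measurable for it, which is the remaining inclusion. *)
pose T := g_sigma_algebraType [set A : set 'rV[R]_n | closed A].
suff : measurable_fun [set: T] (rV_coord i : T -> measurableTypeR R).
  by move=> /(_ measurableT _ mB); rewrite setTI.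
apply: (measurability _ (@RGenCInfty.measurableE R)).
move=> _ [_ [x ->] <-]; rewrite setTI; apply: sub_sigma_algebra => /=.
rewrite set_itvE; apply: (closed_comp (f := fun y : 'rV[R]_n => y 0 i)).
  by move=> y _; exact: coord_continuous.
exact: closed_ge.
Qed.

End row_vector_norm.

(** * Lebesgue measure of Lipschitz images *)

Section lebesgue_rV_cubes.
Context {R : realType}.

Lemma measurable_rV_coords n (A : 'I_n -> set (measurableTypeR R)) :
  (forall i, measurable (A i)) -> measurable [set x : 'rV[R]_n | forall i, A i (x 0 i)].
Proof.
move=> mA.
rewrite (_ : [set x | _] = \bigcap_(i in [set` 'I_n]) (rV_coord i @^-1` A i)).
  apply: fin_bigcap_measurable; first exact: finite_finset.
  move=> i _; rewrite -[X in measurable X]setTI.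
  exact: measurable_rV_coord.
by apply/seteqP; split=> [y h i _|y h i]; apply: h.
Qed.

(** The sides are arbitrary sets of length d, so that half-open grid cells and closed boxes are both
    instances. *)
Lemma lebesgue_rV_cube n (A : 'I_n -> set (measurableTypeR R)) (d : R) :
  (forall i, measurable (A i)) -> (forall i, lebesgue_measure (A i) = d%:E) ->
  lebesgue_rV n [set x : 'rV[R]_n | forall i, A i (x 0 i)] = (d ^+ n)%:E.
Proof.
elim: n A => [|n IH] A mA dA.
  rewrite expr0 /= diracE mem_set//.
  by move=> -[].
pose A' (i : 'I_n) := A (lift ord_max i).
have snocE : @rV_snoc R n @^-1` [set x : 'rV[R]_n.+1 | forall i, A i (x 0 i)] =
    [set x : 'rV[R]_n | forall i, A' i (x 0 i)] `*` A ord_max.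
  apply/seteqP; split=> [[x t] /= h|[x t] /= [h1 h2] i].
    split => [i|].
      by have := h (lift ord_max i); rewrite mxE liftK.
    by have := h ord_max; rewrite mxE unlift_none.
  rewrite mxE; case: unliftP => [j|] -> //=; exact: h1.
rewrite -[LHS]/((lebesgue_rV n \x lebesgue_measure)%E (@rV_snoc R n @^-1` _)) snocE.
rewrite product_measure1E; [|by apply: measurable_rV_coords => i; exact: mA|exact: mA].
rewrite IH; [|move=> i; exact: mA|move=> i; exact: dA].
by rewrite [X in (_ * X)%E](dA ord_max) exprSr EFinM.
Qed.

End lebesgue_rV_cubes.

Section lipschitz_image.
Context {R : realType} {n : nat}.
Implicit Types (x y : 'rV[R]_n) (K : set 'rV[R]_n) (s c d : R).
Notation lam := (lebesgue_rV n).

(** Half-open sides make the cells of positive mesh s a partition of the space. *)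
Definition grid_cell s (z : 'rV[int]_n) : set 'rV[R]_n :=
  [set x : 'rV[R]_n | forall i, `[(z 0 i)%:~R * s, (z 0 i + 1)%:~R * s[%classic (x 0 i)].

Lemma measurable_grid_cell s z : measurable (grid_cell s z).
Proof.
by apply: (measurable_rV_coords (A := fun i => `[_, _[%classic)) => i; exact: measurable_itv.
Qed.

Lemma lebesgue_grid_cell s z : 0 <= s -> lam (grid_cell s z) = (s ^+ n)%:E.
Proof.
move=> s0; apply: (lebesgue_rV_cube (A := fun i => `[_, _[%classic)) => i;
  first exact: measurable_itv.
rewrite lebesgue_measure_itv /= lte_fin intrD mulrDl mul1r.
case: ltP => [_|]; first by rewrite -EFinB; congr (_%:E); ring.
by rewrite gerDl => s0'; congr EFin; apply/eqP; rewrite eq_le s0 s0'.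
Qed.

Lemma grid_cellP s x : 0 < s -> grid_cell s (\row_i Num.floor (x 0 i / s)) x.
Proof.
move=> s0 i; rewrite /= mxE in_itv /= -ler_pdivlMr// -ltr_pdivrMr//.
by rewrite floor_le_tmp /= floorD1_gt.
Qed.

Lemma grid_cell_inj s z z' x : 0 < s -> grid_cell s z x -> grid_cell s z' x -> z = z'.
Proof.
move=> s0 h h'; apply/rowP => i; move: (h i) (h' i).
rewrite /= !in_itv /= -!ler_pdivlMr// -!ltr_pdivrMr// => h1 h2.
have e k : (k%:~R <= x 0 i / s < (k + 1)%:~R) -> k = Num.floor (x 0 i / s).
  by move=> h0; apply/esym/floor_def.
by rewrite (e _ h1) (e _ h2).
Qed.

Lemma grid_cell_dist s z x y : 0 <= s -> grid_cell s z x -> grid_cell s z y ->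
  `|x - y| <= s.
Proof.
move=> s0 hx hy; rewrite ler_rV_norm//; apply/forallP => i.
move: (hx i) (hy i); rewrite /= !in_itv /= !mxE !intrD !mulrDl !mul1r.
by move=> /andP[a b] /andP[c d]; rewrite ler_norml; lra.
Qed.

(** For the sup norm, a set of diameter d fits in a cube of side d placed at the coordinatewise
    infima, without any dimensional constant. The cube B stands in for S, whose measurability is
    unknown in the application. *)
Lemma small_set_measure (S : set 'rV[R]_n) d : 0 <= d ->
  (forall x y, S x -> S y -> `|x - y| <= d) ->
  exists B, [/\ measurable B, S `<=` B & lam B = (d ^+ n)%:E].
Proof.
(* The infima below call for a nonempty S; for the empty set any cube of side d serves. *)
move=> d0 Sd; have [S0|/set0P[x0 Sx0]] := eqVneq S set0.
  exists [set x : 'rV[R]_n | forall i, `[0, d]%classic (x 0 i)]; split.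
  - by apply: (measurable_rV_coords (A := fun i => `[_, _]%classic)) => i; exact: measurable_itv.
  - by rewrite S0.
  - apply: (lebesgue_rV_cube (A := fun i => `[_, _]%classic)) => i; first exact: measurable_itv.
    rewrite lebesgue_measure_itv /= lte_fin.
    case: ltP => [_|?]; first by rewrite -EFinB subr0.
    by congr EFin; apply/eqP; rewrite eq_le d0 /=.
pose a i := inf [set x 0 i | x in S].
have h x y i : S x -> S y -> x 0 i - d <= y 0 i.
  move=> Sx Sy; have := le_trans (rV_coord_le_norm (x - y) i) (Sd _ _ Sx Sy).
  by rewrite !mxE ler_norml; lra.
exists [set x : 'rV[R]_n | forall i, `[a i, a i + d]%classic (x 0 i)]; split.
- by apply: (measurable_rV_coords (A := fun i => `[_, _]%classic)) => i; exact: measurable_itv.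
- move=> x Sx i /=; rewrite in_itv/=; apply/andP; split.
    apply: ge_inf; last by exists x.
    by exists (x0 0 i - d) => _ [y Sy <-]; exact: h.
  rewrite -lerBlDr; apply: lb_le_inf; first by exists (x0 0 i); exists x0.
  by move=> _ [y Sy <-]; exact: h.
- apply: (lebesgue_rV_cube (A := fun i => `[_, _]%classic)) => i; first exact: measurable_itv.
  rewrite lebesgue_measure_itv /= lte_fin.
  case: ltP => [_|]; first by rewrite -EFinB; congr EFin; ring.
  by rewrite gerDl => ?; congr EFin; apply/eqP; rewrite eq_le d0 /=.
Qed.

Definition thickening K d := \bigcup_(x in K) ball x d.

Lemma open_thickening K d : open (thickening K d).
Proof. by apply: bigcup_open => x _; exact: ball_open. Qed.

Lemma bounded_lebesgue_fin (B : set 'rV[R]_n) M : measurable B ->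
  (forall x, B x -> `|x| <= M) -> (lam B < +oo)%E.
Proof.
move=> mB BM; have M0 : 0 <= Num.max 0 M by rewrite le_max lexx.
have [||C [mC BC lC]] := @small_set_measure B (Num.max 0 M *+ 2).
- by rewrite mulrn_wge0.
- move=> x y /BM xM /BM yM; rewrite (le_trans (ler_normB _ _))// mulr2n.
  by rewrite lerD// le_max ?xM ?yM orbT.
- by apply: (@le_lt_trans _ _ (lam C)); [apply: le_measure; rewrite ?inE|rewrite lC ltry].
Qed.

Lemma compact_norm_bounded K : compact K -> exists M, forall x, K x -> `|x| <= M.
Proof.
move=> /compact_bounded[M [_ h]]; exists (M + 1) => x Kx.
by apply: h Kx; rewrite ltrDl.
Qed.

Lemma compact_lebesgue_fin K : compact K -> (lam K < +oo)%E.
Proof.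
move=> cK; have [M KM] := compact_norm_bounded cK.
by apply: bounded_lebesgue_fin KM; exact: compact_measurable_rV.
Qed.

(** Being closed, K is the intersection of its neighborhoods; being bounded, it has neighborhoods of
    finite measure, so the measure is continuous along this decreasing sequence. *)
Lemma thickening_cvg K : compact K ->
  lam (thickening K k.+1%:R^-1) @[k --> \oo] --> lam K.
Proof.
move=> cK; have [M KM] := compact_norm_bounded cK.
pose F k := thickening K k.+1%:R^-1.
have KE : K = \bigcap_k F k.
  apply/seteqP; split=> [x Kx k _|x h].
    by exists x => //; apply: ballxx; rewrite invr_gt0 ltr0n.
  rewrite (closure_id K).1; last exact: compact_closed.
  move=> B /nbhs_ballP[e /= e0 eB].
  have [k _ /(_ k (leqnn k)) ke] := near_infty_natSinv_lt (PosNum e0).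
  have [y Ky yx] := h k I; exists y; split=> //.
  by apply: eB; apply: ball_sym; apply: le_ball yx; exact: ltW.
have mF k : measurable (F k) by apply: open_measurable_rV; exact: open_thickening.
suff : lam \o F @ \oo --> lam (\bigcap_k F k) by rewrite -KE.
apply: nonincreasing_cvg_mu => //.
- apply: (@bounded_lebesgue_fin _ (M + 1)) => // x [y Ky].
  rewrite -ball_normE /ball_/= invr1 => /ltW yx.
  rewrite -(subrK y x) (le_trans (ler_normD _ _))// addrC lerD ?KM//.
  by rewrite distrC.
- by apply: bigcap_measurable => // k; exists 0%N.
- move=> k l kl; apply/subsetPset => x [y Ky yx]; exists y => //.
  by apply: le_ball yx; rewrite lef_pV2 ?posrE ?ltr0n// ler_nat.
Qed.

(** A grid cell that meets K carries a piece of K whose image fits in a cube of side c times the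
    mesh, hence of measure [c ^+ n] times that of the cell. The cells are disjoint but may stick out
    of K, whence the neighborhood of K. *)
Lemma lipschitz_image_thickening K (g : 'rV[R]_n -> 'rV[R]_n) c d :
  0 <= c -> 0 < d -> measurable (g @` K) ->
  (forall x y, K x -> K y -> `|g x - g y| <= c * `|x - y|) ->
  (lam (g @` K) <= (c ^+ n)%:E * lam (thickening K d))%E.
Proof.
(* Any mesh below d would do: points of one cell are at distance at most s, and balls of radius d
   are open. *)
move=> c0 d0 mgK gc; pose s := d / 2.
have s0 : 0 < s by rewrite divr_gt0.
(* Cells numbered by their codes, since countable subadditivity speaks of sequences; a number coding
   no cell, or a cell that misses K, gives the empty set. *)
pose C (k : nat) : set 'rV[R]_n :=
  if pickle_inv k is Some z then
    if pselect (K `&` grid_cell s z !=set0) then grid_cell s z else set0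
  else set0.
have mC k : measurable (C k).
  rewrite /C; case: (pickle_inv _) => // z; case: pselect => //= ?.
  exact: measurable_grid_cell.
have tC : trivIset setT C.
  move=> i j _ _ [x []]; rewrite /C.
  case Ei : (pickle_inv i) => [z|//]; case: pselect => //= ? zx.
  case Ej : (pickle_inv j) => [z'|//]; case: pselect => //= ? z'x.
  have := @pickle_invK 'rV[int]_n i; rewrite Ei /= => <-.
  have := @pickle_invK 'rV[int]_n j; rewrite Ej /= => <-.
  by rewrite (grid_cell_inj s0 zx z'x).
have CK : \bigcup_k C k `<=` thickening K d.
  move=> x [k _]; rewrite /C; case: (pickle_inv _) => // z.
  case: pselect => //= -[y [Ky zy]] zx; exists y => //.
  rewrite -ball_normE /ball_/=; apply: (le_lt_trans (grid_cell_dist (ltW s0) zy zx)).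
  by rewrite /s ltr_pdivrMr//; lra.
have hB k : exists B, [/\ measurable B, g @` (K `&` C k) `<=` B &
    (lam B <= (c ^+ n)%:E * lam (C k))%E].
  (* An empty piece is covered by the empty set: a cube of side [c * s] would be too large against
     measure 0. *)
  have [C0|/set0P[x0 Cx0]] := eqVneq (C k) set0.
    by exists set0; rewrite C0 setI0 image_set0 !measure0 mule0; split.
  have [B [mB gB lB]] : exists B, [/\ measurable B, g @` (K `&` C k) `<=` B &
      lam B = ((c * s) ^+ n)%:E].
    apply: small_set_measure; first by rewrite mulr_ge0// ltW.
    move=> _ _ [x [Kx Cx] <-] [y [Ky Cy] <-].
    rewrite (le_trans (gc _ _ Kx Ky))// ler_wpM2l//.
    move: Cx Cy; rewrite /C; case: (pickle_inv _) => // z; case: pselect => //= ?.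
    exact: grid_cell_dist (ltW s0).
  exists B; split=> //; rewrite lB exprMn EFinM.
  rewrite (_ : lam (C k) = (s ^+ n)%:E)//.
  move: Cx0; rewrite /C; case: (pickle_inv _) => // z; case: pselect => //= ? ?.
  exact: lebesgue_grid_cell (ltW s0).
have /choice[B hB'] := hB.
apply: (@le_trans _ _ (\sum_(k <oo) lam (B k))%E).
  apply: measure_sigma_subadditive => // [k|y [x Kx <-]]; first by case: (hB' k).
  pose z := \row_i Num.floor (x 0 i / s).
  exists (pickle z) => //; case: (hB' (pickle z)) => _ + _; apply.
  exists x => //; split=> //; rewrite /C pickleK_inv.
  have zx : grid_cell s z x := grid_cellP x s0.
  by case: pselect => //= -[]; exists x.
apply: (@le_trans _ _ (\sum_(k <oo) ((c ^+ n)%:E * lam (C k)))%E).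
  by apply: lee_nneseries => // k _; case: (hB' k).
rewrite nneseriesZl// lee_wpmul2l ?lee_fin ?exprn_ge0//.
rewrite -measure_semi_bigcup//; last exact: bigcupT_measurable.
apply: le_measure => //; rewrite ?inE; first exact: bigcupT_measurable.
apply: open_measurable_rV; exact: open_thickening.
Qed.

(** Let d tend to 0 in [lipschitz_image_thickening]: the overhang of the grid disappears in the
    limit. *)
Lemma lipschitz_image_le K (g : 'rV[R]_n -> 'rV[R]_n) c :
  0 <= c -> compact K -> measurable (g @` K) ->
  (forall x y, K x -> K y -> `|g x - g y| <= c * `|x - y|) ->
  (lam (g @` K) <= (c ^+ n)%:E * lam K)%E.
Proof.
move=> c0 cK mgK gc.
have cn : ((c ^+ n)%:E * lam (thickening K k.+1%:R^-1))%E @[k --> \oo] -->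
    ((c ^+ n)%:E * lam K)%E.
  by apply: cvgeZl => //; exact: thickening_cvg.
rewrite -(cvg_lim _ cn)//; apply: lime_ge; first by apply/cvg_ex; eexists; exact: cn.
apply: nearW => k; apply: lipschitz_image_thickening => //.
Qed.

End lipschitz_image.

(** * Lebesgue measure under linear maps *)

Section continuity.
Context {R : realType}.

Lemma cvg_mx (T : Type) (F : set_system T) {FF : Filter F} m n
    (f : T -> 'M[R]_(m, n)) (M : 'M[R]_(m, n)) :
  (forall i j, f x i j @[x --> F] --> M i j) -> f x @[x --> F] --> M.
Proof.
move=> h; apply/cvg_ballP => e e0.
have : \forall x \near F, forall ij : 'I_m * 'I_n, ball (M ij.1 ij.2) e (f x ij.1 ij.2).
  by apply: filter_forall => -[i j]; move: (h i j) => /cvg_ballP/(_ _ e0).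
by apply: filterS => x hx; split=> // i j; exact: (hx (i, j)).
Qed.

Lemma within_continuous_measurable_rV m n (D : set 'rV[R]_m)
    (f : 'rV[R]_m -> 'rV[R]_n) :
  closed D -> {within D, continuous f} -> measurable_fun D f.
Proof.
move=> cD /continuous_closedP cf.
apply: (measurability _ measurable_rVE) => _ [C cC <-].
apply: closed_measurable_rV; rewrite closed_setSI//; exact: cf.
Qed.

Lemma within_continuous_measurable m (D : set 'rV[R]_m)
    (f : 'rV[R]_m -> measurableTypeR R) :
  closed D -> {within D, continuous (f : 'rV[R]_m -> R)} -> measurable_fun D f.
Proof.
move=> cD /continuous_closedP cf.
apply: (measurability _ (@RGenCInfty.measurableE R)) => _ [_ [x ->] <-].
apply: closed_measurable_rV; rewrite closed_setSI//; apply: cf.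
by rewrite set_itvE; exact: closed_ge.
Qed.

(** An upper bound for the operator norm between sup norms. Its exact value is irrelevant to the
    estimates, and a finite sum over the entries is visibly continuous in A. *)
Definition mx_sum_norm m n (A : 'M[R]_(m, n)) : R := \sum_i \sum_j `|A i j|.

Lemma mx_sum_norm_ge0 m n (A : 'M[R]_(m, n)) : 0 <= mx_sum_norm A.
Proof. by apply: sumr_ge0 => i _; apply: sumr_ge0. Qed.

Lemma norm_mulmx_le m n (x : 'rV[R]_m) (A : 'M[R]_(m, n)) :
  `|x *m A| <= mx_sum_norm A * `|x|.
Proof.
rewrite ler_rV_norm; last by rewrite mulr_ge0 ?mx_sum_norm_ge0.
apply/forallP => j; rewrite mxE (le_trans (ler_norm_sum _ _ _))//.
rewrite /mx_sum_norm mulr_suml; apply: ler_sum => i _.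
rewrite normrM mulrC ler_pM// ?rV_coord_le_norm//.
by rewrite (bigD1 j)//= lerDl sumr_ge0.
Qed.

Lemma lipschitz_within_continuous m n (f : 'rV[R]_m -> 'rV[R]_n) (K : set 'rV[R]_m) c :
  (forall x y, K x -> K y -> `|f x - f y| <= c * `|x - y|) ->
  {within K, continuous f}.
Proof.
move=> fc; apply/subspace_continuousP => x Kx; apply/cvgrPdist_lt => e e0.
have c1 : 0 < `|c| + 1 by rewrite ltr_wpDl.
have xe : \forall y \near x, `|x - y| < e / (`|c| + 1).
  by apply/nbhs_normP; exists (e / (`|c| + 1)) => //=; rewrite divr_gt0.
near=> y; have Ky : K y by near: y; exact: withinT.
rewrite (le_lt_trans (fc _ _ Kx Ky))// (@le_lt_trans _ _ ((`|c| + 1) * `|x - y|))//.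
  by rewrite ler_wpM2r// (le_trans (ler_norm _))// lerDl.
rewrite mulrC -ltr_pdivlMr//.
by near: y; apply: cvg_within.
Unshelve. all: by end_near. Qed.

Lemma continuous_mulmxr m n (A : 'M[R]_(m, n)) :
  continuous (fun x : 'rV[R]_m => x *m A).
Proof.
apply/continuous_subspace_setT; apply: (@lipschitz_within_continuous _ _ _ _ (mx_sum_norm A)).
by move=> x y _ _; rewrite -mulmxBl; exact: norm_mulmx_le.
Qed.

Lemma measurable_mulmxr m n (A : 'M[R]_(m, n)) :
  measurable_fun setT (fun x : 'rV[R]_m => x *m A).
Proof.
apply: within_continuous_measurable_rV; first exact: closedT.
by apply: continuous_subspaceT; exact: continuous_mulmxr.
Qed.

End continuity.

Section linear_maps.
Context {R : realType}.
Notation lam := (lebesgue_rV _).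

(** The right-hand side is a measure in B, and Lebesgue measure is characterized by its values on
    half-open intervals, so only these are computed. *)
Lemma lebesgue_measure_affine (b d : R) (B : set (measurableTypeR R)) :
  d != 0 -> measurable B ->
  lebesgue_measure B =
  (`|d|%:E * lebesgue_measure
    ((fun t : measurableTypeR R => (b + t * d)%R : measurableTypeR R) @^-1` B))%E.
Proof.
move=> d0 mB; pose f (t : measurableTypeR R) : measurableTypeR R := b + t * d.
have mf : measurable_fun setT f.
  apply: (@continuous_measurable_fun R (fun t => b + t * d)) => t.
  by apply: cvgD; [exact: cvg_cst|apply: cvgMl].
pose mu := mscale (NngNum (normr_ge0 d))
  (measure_function_pushforward__canonical__measure_function_Measure lebesgue_measure mf).
apply: (@lebesgue_measure_unique R mu) => // X [[u v] _ <-] /=.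
rewrite /mu /mscale /= /pushforward.
have [d_gt0|d_lt0|d00] := ltrgtP 0 d; last by rewrite d00 eqxx in d0.
- rewrite (_ : f @^-1` _ = `](u - b) / d, (v - b) / d]%classic); last first.
    apply/seteqP; split=> t; rewrite /f /= !in_itv/= ltr_pdivrMr// ler_pdivlMr//;
    by rewrite ltrBlDl lerBrDl.
  rewrite !lebesgue_measure_itv/= !lte_fin ltr_pM2r ?invr_gt0// ltrD2r.
  case: ifPn => _; last by rewrite mule0.
  by rewrite gtr0_norm// -!EFinB -EFinM; congr EFin; field.
(* A negative slope exchanges the open and the closed end. *)
- rewrite (_ : f @^-1` _ = `[(v - b) / d, (u - b) / d[%classic); last first.
    apply/seteqP; split=> t; rewrite /f /= !in_itv/= ltr_ndivlMr// ler_ndivrMr//;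
    by rewrite ltrBlDl lerBrDl andbC.
  rewrite !lebesgue_measure_itv/= !lte_fin ltr_nM2r ?invr_lt0// ltrD2r.
  case: ifPn => _; last by rewrite mule0.
  by rewrite ltr0_norm// -!EFinB -EFinM; congr EFin; field.
Qed.

(* Triangularity makes the last coordinate of x *m T affine in the last
   coordinate of x and the other ones independent of it, which is what the
   recursive definition of the measure can integrate. *)
Lemma lebesgue_rV_triangular n (T : 'M[R]_n) (B : set 'rV[R]_n) :
  is_trig_mx T^T -> \det T != 0 -> measurable B ->
  lam B = (`|\det T|%:E * lam ((fun x => x *m T) @^-1` B))%E.
Proof.
elim: n T B => [|n IH] T B Ttrig detT mB.
  rewrite det_mx00 normr1 mul1e; congr (lam _).
  by apply/seteqP; split=> x /=; rewrite (thinmx0 x) (thinmx0 (_ *m _)).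
pose T' : 'M[R]_n := \matrix_(i, j) T (lift ord_max i) (lift ord_max j).
pose b (x : 'rV[R]_n) := \sum_i x 0 i * T (lift ord_max i) ord_max.
pose d := T ord_max ord_max.
have T0 (i j : 'I_n.+1) : (j < i)%N -> T i j = 0.
  by move=> ij; move/is_trig_mxP: Ttrig => /(_ j i ij); rewrite mxE.
have liftE (i : 'I_n) : lift ord_max i = widen_ord (leqnSn n) i.
  by apply: val_inj; exact: lift_max.
have T'trig : is_trig_mx T'^T.
  by apply/is_trig_mxP => i j ij; rewrite !mxE T0// !lift_max.
have detE : \det T = \det T' * d.
  rewrite -det_tr -(det_tr T') !det_trig// big_ord_recr/= mxE; congr (_ * _).
  by apply: eq_bigr => i _; rewrite !mxE liftE.
have snocT x t : rV_snoc (x, t) *m T = rV_snoc (x *m T', b x + t * d).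
  apply/rowP => j; rewrite !mxE big_ord_recr/= !mxE unlift_none/=.
  under eq_bigr do rewrite mxE -liftE liftK/=.
  case: unliftP => [k|] ->; last by [].
  rewrite T0 ?mulr0 ?addr0 ?lift_max//= mxE.
  by apply: eq_bigr => i _; rewrite mxE.
have := detT; rewrite detE mulf_eq0 negb_or => /andP[detT' d0].
pose C := @rV_snoc R n @^-1` B.
have mC : measurable C by rewrite -[C]setTI; exact: measurable_rV_snoc.
pose F (x : 'rV[R]_n) := lebesgue_measure (xsection C x).
have mF : measurable_fun setT F by exact: measurable_fun_xsection.
have F0 x : (0 <= F x)%E by [].
have -> : lam B = (\int[lam]_x F x)%E by [].
have -> : lam ((fun x => x *m T) @^-1` B) = (\int[lam]_x (`|d|^-1%:E * F (x *m T')))%E.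
  rewrite -[LHS]/(\int[lam]_x lebesgue_measure (xsection _ x))%E.
  apply: eq_integral => x _.
  rewrite /F [X in _ = (_ * X)%E](lebesgue_measure_affine (b x) d0); last first.
    exact: measurable_xsection.
  rewrite muleA -EFinM mulVf ?normr_eq0// mul1e; congr (lebesgue_measure _).
  by apply/seteqP; split=> t; rewrite /xsection/= !inE/= snocT.
have mFT : measurable_fun setT (fun x => F (x *m T')).
  by apply: (measurableT_comp mF); exact: measurable_mulmxr.
rewrite ge0_integralZl_EFin// ?invr_ge0//.
pose mu := measure_function_pushforward__canonical__measure_function_Measure lam
  (measurable_mulmxr T').
have -> : (\int[lam]_x F (x *m T') = \int[mu]_x F x)%E.
  rewrite (ge0_integral_pushforward (measurable_mulmxr T') lam measurableT mF).
    by rewrite preimage_setT.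
  by move=> y _; exact: F0.
(* The induction hypothesis as an identity of measures: [lam] is [|\det T'|] times its pushforward
   [mu]. *)
rewrite (eq_measure_integral (mscale (NngNum (normr_ge0 (\det T'))) mu)); last first.
  by move=> A mA _; rewrite (IH T' A).
rewrite ge0_integral_mscale//= muleA -EFinM; congr (_%:E * _)%E.
by rewrite normrM mulfK ?normr_eq0.
Qed.

Lemma lebesgue_rV_linear_triangular n (T : 'M[R]_n) (K : set 'rV[R]_n) :
  is_trig_mx T^T -> \det T != 0 -> compact K ->
  lam ((fun x => x *m T) @` K) = (`|\det T|%:E * lam K)%E.
Proof.
move=> Ttrig detT cK; rewrite (lebesgue_rV_triangular Ttrig detT).
  congr (_ * lam _)%E; apply/seteqP; split=> [x [y Ky /= yx]|x Kx]; last by exists x.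
  have uT : T \in unitmx by rewrite unitmxE unitfE.
  by rewrite -(mulmxK uT x) -yx mulmxK.
apply: compact_measurable_rV; apply: continuous_compact => //.
by apply: continuous_subspaceT; exact: continuous_mulmxr.
Qed.

(* Permutations of the coordinates are isometries for the sup norm. *)
Lemma lebesgue_rV_perm n (s : 'S_n) (K : set 'rV[R]_n) : compact K ->
  lam ((fun x => x *m perm_mx s) @` K) = lam K.
Proof.
have le (u : 'S_n) (A : set 'rV[R]_n) : compact A ->
    compact ((fun x => x *m perm_mx u) @` A) /\
    (lam ((fun x => x *m perm_mx u) @` A) <= lam A)%E.
  move=> cA; have cuA : compact ((fun x => x *m perm_mx u) @` A).
    apply: continuous_compact => //.
    by apply: continuous_subspaceT; exact: continuous_mulmxr.
  split=> //; have := @lipschitz_image_le R n A (fun x => x *m perm_mx u) 1.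
  rewrite expr1n mul1e; apply => //; first exact: compact_measurable_rV.
  move=> x y _ _; rewrite -mulmxBl mul1r -(invgK u) -col_permE.
  rewrite ler_rV_norm//; apply/forallP => i; rewrite mxE.
  exact: rV_coord_le_norm.
move=> cK; apply/eqP; rewrite eq_le; have [cs ->] := le s K cK; rewrite /=.
have [_] := le (s^-1)%g _ cs; congr (lam _ <= _)%E.
rewrite image_comp; apply/seteqP; split=> [x [y Ky <-]|x Kx] /=.
  by rewrite -mulmxA -perm_mxM mulgV perm_mx1 mulmx1.
by exists x => //=; rewrite -mulmxA -perm_mxM mulgV perm_mx1 mulmx1.
Qed.

(** The scaling law is stable under products of matrices, so it suffices to have it for the factors
    of an LUP decomposition. *)
Lemma lebesgue_rV_linear n (A : 'M[R]_n) (K : set 'rV[R]_n) :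
  A \in unitmx -> compact K ->
  lam ((fun x => x *m A) @` K) = (`|\det A|%:E * lam K)%E.
Proof.
pose P (B : 'M[R]_n) := forall K : set 'rV[R]_n, compact K ->
  lam ((fun x => x *m B) @` K) = (`|\det B|%:E * lam K)%E.
have PM B C : P B -> P C -> P (B *m C).
  move=> PB PC L cL; rewrite det_mulmx normrM mulrC EFinM -muleA -PB// -PC.
    rewrite image_comp; congr (lam _); apply: eq_imagel => x _ /=.
    by rewrite mulmxA.
  apply: continuous_compact => //.
  by apply: continuous_subspaceT; exact: continuous_mulmxr.
have Pperm s : P (perm_mx s).
  by move=> L cL; rewrite lebesgue_rV_perm// det_perm normrX normrN1 expr1n mul1e.
suff PA : A \in unitmx -> P A by move=> /PA; apply.
(* The decomposition is stated for positive sizes, so size 0 is settled apart. *)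
case: n => [|n] in A K P PM Pperm *.
  move=> _ L cL; rewrite det_mx00 normr1 mul1e; congr (lam _).
  apply/seteqP; split=> [x [y Ly _]|x Lx]; first by rewrite (thinmx0 x) -(thinmx0 y).
  by exists x => //; rewrite (thinmx0 x) (thinmx0 (_ *m _)).
move=> uA.
have := cormen_lup_correct A; have := cormen_lup_perm A.
have := cormen_lup_detL A; have := cormen_lup_lower A; have := @cormen_lup_upper _ _ A.
case: (cormen_lup A) => [[Q L] U] /= Uu Ll detL /is_perm_mxP[s Qs] PAE.
rewrite -!mulmxE in PAE.
have detU : \det U != 0.
  have : \det (Q *m A) != 0.
    rewrite det_mulmx mulf_neq0//; last by rewrite -unitfE -unitmxE.
    by rewrite Qs det_perm signr_eq0.
  by rewrite PAE det_mulmx mulf_eq0 negb_or => /andP[].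
have PU : P U.
  move=> B cB; apply: lebesgue_rV_linear_triangular => //.
  by apply/is_trig_mxP => i j ij; rewrite mxE Uu.
(* The triangular case above is for upper triangular matrices; conjugation by the reversal of the
   indices turns the lower triangular factor into an upper one. *)
pose r := perm (@rev_ord_inj n.+1).
pose L' := row_perm r (col_perm r L).
have PL' : P L'.
  move=> B cB; apply: lebesgue_rV_linear_triangular => //.
    apply/is_trig_mxP => i j ij; rewrite !mxE !permE Ll/=; last by lia.
    by rewrite (inj_eq rev_ord_inj) eq_sym -val_eqE ltn_eqF.
  by rewrite /L' row_permE col_permE !det_mulmx !det_perm detL !mulf_neq0 ?signr_eq0 ?oner_eq0.
have -> : A = perm_mx s^-1 *m (perm_mx r^-1 *m L' *m perm_mx r *m U).
  rewrite /L' row_permE col_permE -!mulmxA (mulmxA (perm_mx r^-1)) -perm_mxM.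
  rewrite mulVg perm_mx1 mul1mx (mulmxA (perm_mx r^-1)) -perm_mxM.
  rewrite mulVg perm_mx1 mul1mx -PAE Qs mulmxA -perm_mxM.
  by rewrite mulVg perm_mx1 mul1mx.
apply: (PM _ _ (Pperm _) (PM _ _ (PM _ _ (PM _ _ (Pperm _) PL') (Pperm _)) PU)).
Qed.

End linear_maps.

(** * Change of variables *)

Section mdensity.
Local Open Scope ereal_scope.
Context d (T : measurableType d) (R : realType).
Variables (mu : {measure set T -> \bar R}) (f : T -> R).

(* The two hypotheses are arguments so that the measure structure can be
   inferred from the term. *)
Definition mdensity of measurable_fun setT f & (forall x, (0 <= f x)%R) : set T -> \bar R :=
  fun A => \int[mu]_(x in A) (f x)%:E.

Hypotheses (mf : measurable_fun setT f) (f0 : forall x, (0 <= f x)%R).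

Let mdensity0 : mdensity mf f0 set0 = 0.
Proof. by rewrite /mdensity integral_set0. Qed.

Let mdensity_ge0 A : 0 <= mdensity mf f0 A.
Proof. by apply: integral_ge0 => x _; rewrite lee_fin. Qed.

Let mdensity_sigma_additive : semi_sigma_additive (mdensity mf f0).
Proof.
move=> /= F mF tF mUF; rewrite /mdensity ge0_integral_bigcup//; last 2 first.
- by apply/measurable_EFinP; exact: measurable_funTS.
- by move=> x _; rewrite lee_fin.
apply: is_cvg_ereal_nneg_natsum_cond => k _ _.
by apply: integral_ge0 => x _; rewrite lee_fin.
Qed.

HB.instance Definition _ := isMeasure.Build _ _ _ (mdensity mf f0)
  mdensity0 mdensity_ge0 mdensity_sigma_additive.

Import HBNNSimple.

(** For simple functions linearity reduces this to the definition of [mdensity] on level sets;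
    monotone convergence extends it to g. *)
Lemma ge0_integral_mdensity (D : set T) (g : T -> \bar R) :
  measurable D -> measurable_fun D g -> (forall x, D x -> 0 <= g x) ->
  \int[mdensity mf f0]_(x in D) g x = \int[mu]_(x in D) (g x * (f x)%:E).
Proof.
move=> mD mg g0; pose g_ := nnsfun_approx mD mg.
have mfD : measurable_fun D (EFin \o f).
  by apply/measurable_EFinP; exact: measurable_funTS.
have f0' x : 0 <= (f x)%:E by rewrite lee_fin.
have mgn n : measurable_fun D (fun x => (g_ n x)%:E).
  by apply/measurable_EFinP; exact: measurable_funTS.
have step n : \int[mdensity mf f0]_(x in D) (g_ n x)%:E =
    \int[mu]_(x in D) ((g_ n x)%:E * (f x)%:E).
  have mh r : measurable (g_ n @^-1` [set r]) by [].
  under [LHS]eq_integral do rewrite fimfunE -fsumEFin//.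
  rewrite ge0_integral_fsum//; last 2 first.
  - by move=> r; apply/measurable_EFinP/measurable_funM.
  - by move=> r x _; rewrite nnfun_muleindic_ge0.
  transitivity (\int[mu]_(x in D)
      \sum_(r \in range (g_ n)) ((r * \1_(g_ n @^-1` [set r]) x)%:E * (f x)%:E)).
    rewrite ge0_integral_fsum//; last 2 first.
    - by move=> r; apply: emeasurable_funM => //; apply/measurable_EFinP/measurable_funM.
    - by move=> r x _; rewrite mule_ge0// nnfun_muleindic_ge0.
    apply: eq_fsbigr => r; rewrite inE => -[y _ gy].
    rewrite integralZl_indic_nnsfun// integral_indic//.
    transitivity (r%:E * \int[mu]_(x in D `&` g_ n @^-1` [set r]) (f x)%:E).
      by rewrite setIC.
    rewrite integral_mkcondr.
    under [RHS]eq_integral do rewrite EFinM -muleA.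
    rewrite ge0_integralZl_EFin//.
    - congr (_ * _); apply: eq_integral => x _; rewrite patchE indicE.
      by case: ifPn => _; rewrite ?mul1e ?mul0e.
    - by move=> x _; rewrite mule_ge0// lee_fin.
    - by apply: emeasurable_funM => //; apply/measurable_EFinP.
    - by rewrite -gy.
  apply: eq_integral => x _; rewrite [in RHS]fimfunE -fsumEFin// ge0_mule_fsuml//.
  by move=> r; rewrite nnfun_muleindic_ge0.
transitivity (limn (fun n => \int[mdensity mf f0]_(x in D) (g_ n x)%:E)).
  rewrite -monotone_convergence//.
  - apply: eq_integral => x /set_mem Dx; apply/esym/cvg_lim => //.
    exact: cvg_nnsfun_approx.
  - by move=> n x Dx; rewrite lee_fin.
  - by move=> x Dx m n mn; rewrite lee_fin; exact/lefP/nd_nnsfun_approx.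
under eq_fun do rewrite step.
rewrite -monotone_convergence//.
- apply: eq_integral => x /set_mem Dx; apply/cvg_lim => //.
  by apply: cvgeZr => //; exact: cvg_nnsfun_approx.
- by move=> n; apply: emeasurable_funM.
- by move=> n x Dx; rewrite mule_ge0// lee_fin.
- move=> x Dx m n mn; rewrite lee_wpmul2r// lee_fin; exact/lefP/nd_nnsfun_approx.
Qed.

End mdensity.

(** * Comparison of measures through small compact sets *)

Section local_to_global.
Context {R : realType} {n : nat}.
Implicit Types (K U : set 'rV[R]_n).
Variables mu nu : {measure set 'rV[R]_n -> \bar R}.

(** The local hypothesis speaks of compact pieces only, so the balls of a finite subcover are cut
    out one at a time: removing an open ball leaves a compact set, and the part inside the ball is
    exhausted from within by compact sets. *)
Lemma le_measure_of_local U : compact U ->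
  (forall u, U u -> exists2 d : R, 0 < d & forall K, compact K -> K `<=` U ->
    K `<=` ball u d -> (mu K <= nu K)%E) ->
  (mu U <= nu U)%E.
Proof.
move=> cU loc.
have /choice[d dP] : forall u, exists d : R, U u -> 0 < d /\
    forall K, compact K -> K `<=` U -> K `<=` ball u d -> (mu K <= nu K)%E.
  move=> u; have [Uu|nUu] := pselect (U u); last by exists 0.
  by have [d d0 dP] := loc u Uu; exists d.
have := cU; rewrite compact_cover => /(_ _ U (fun u => ball u (d u))).
case=> [u _|u Uu|D DU UD]; first exact: ball_open.
  by exists u => //; apply: ballxx; have [] := dP u Uu.
(* Generalized to every compact subset of U covered by a finite list of balls, for induction on the
   list. *)
suff H (l : seq 'rV[R]_n) K : {in l, forall u, U u} -> compact K -> K `<=` U ->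
    (forall x, K x -> exists2 u, u \in l & ball u (d u) x) -> (mu K <= nu K)%E.
  apply: (H (finmap.enum_fset D)) => //.
  - by move=> u /DU; rewrite inE.
elim: l K => [|u l IH] K lU cK KU Kl.
  rewrite (_ : K = set0) ?measure0//; apply/seteqP; split=> // x /Kl[u].
  by rewrite in_nil.
have Uu : U u by apply: lU; rewrite inE eqxx.
have [du0 dPu] := dP u Uu.
have mK := compact_measurable_rV cK.
have mB := measurable_rV_ball u (d u).
have E (m : {measure set 'rV[R]_n -> \bar R}) :
    m K = (m (K `&` ball u (d u)) + m (K `\` ball u (d u)))%E.
  by rewrite addeC; apply: measureDI.
rewrite !E; apply: leeD.
  (* Slightly smaller closed balls, empty while the radius is negative, give compact sets increasing
     to the part of K in the open ball. *)
  pose F k := K `&` closed_ball_ Num.norm u (d u - k.+1%:R^-1).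
  have cF k : compact (F k).
    apply: (subclosed_compact _ cK); last by move=> x [].
    apply: closedI.
      exact: (compact_closed (@norm_hausdorff _ _)).
    exact: closed_closed_ball_.
  have mF k := compact_measurable_rV (cF k).
  have FE : K `&` ball u (d u) = \bigcup_k F k.
    apply/seteqP; split=> [x [Kx]|x [k _ [Kx ux]]].
      rewrite -ball_normE /ball_/= -subr_gt0 => ux.
      have [k _ /(_ k (leqnn k)) ke] := near_infty_natSinv_lt (PosNum ux).
      exists k => //; split=> //; rewrite /closed_ball_/=.
      by rewrite lerBrDr addrC -lerBrDr; exact: ltW.
    split=> //; rewrite -ball_normE /ball_/=.
    apply: (le_lt_trans ux); rewrite ltrBlDr ltrDl invr_gt0 ltr0n//.
  have ndF : nondecreasing_seq F.
    move=> k l' kl; apply/subsetPset => x [Kx ux]; split=> //.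
    apply: (le_trans ux); rewrite lerB// lef_pV2 ?posrE ?ltr0n// ler_nat//.
  rewrite FE.
  have mUF : measurable (\bigcup_k F k) by exact: bigcupT_measurable.
  have c1 := nondecreasing_cvg_mu (mu := mu) mF mUF ndF.
  have c2 := nondecreasing_cvg_mu (mu := nu) mF mUF ndF.
  rewrite -(cvg_lim _ c1)// -(cvg_lim _ c2)//; apply: lee_lim.
  - by apply/cvg_ex; eexists; exact: c1.
  - by apply/cvg_ex; eexists; exact: c2.
  - apply: nearW => k /=; apply: dPu => //; first by move=> x [/KU].
    by move=> x Fx; have : (\bigcup_k F k) x by [exists k]; rewrite -FE => -[].
apply: IH.
- by move=> v vl; apply: lU; rewrite inE vl orbT.
- apply: (subclosed_compact _ cK); last exact: subDsetl.
  rewrite setDE; apply: closedI; first exact: (compact_closed (@norm_hausdorff _ _)).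
  by rewrite closedC; exact: ball_open.
- by move=> x [/KU].
- move=> x [Kx nux]; have [v] := Kl x Kx; rewrite inE => /predU1P[->|vl vx]//.
  by exists v.
Qed.

End local_to_global.

(** * Strict differentiability relative to a set *)

Section strict_differentiability.
Context {R : realType}.

(* D acts on row vectors from the right, as the library's Jacobian does. *)
Definition strict_diff m n (U : set 'rV[R]_m) (phi : 'rV[R]_m -> 'rV[R]_n)
    (u : 'rV[R]_m) (D : 'M[R]_(m, n)) : Prop :=
  forall e, 0 < e -> exists2 d, 0 < d &
    forall x y, U x -> U y -> ball u d x -> ball u d y ->
      `|phi x - phi y - (x - y) *m D| <= e * `|x - y|.

Lemma strict_diffS m n (U V : set 'rV[R]_m) (phi : 'rV[R]_m -> 'rV[R]_n) u D :
  V `<=` U -> strict_diff U phi u D -> strict_diff V phi u D.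
Proof.
move=> VU h e /h[d d0 hd]; exists d => // x y Vx Vy; apply: hd; exact: VU.
Qed.

Lemma strict_diff_lipschitz m n (U : set 'rV[R]_m) (phi : 'rV[R]_m -> 'rV[R]_n) u D :
  strict_diff U phi u D -> exists2 d, 0 < d &
    forall x y, U x -> U y -> ball u d x -> ball u d y ->
      `|phi x - phi y| <= (mx_sum_norm D + 1) * `|x - y|.
Proof.
move=> /(_ 1 ltr01)[d d0 hd]; exists d => // x y Ux Uy ux uy.
rewrite -(subrK ((x - y) *m D) (phi x - phi y)) (le_trans (ler_normD _ _))//.
by rewrite addrC mulrDl lerD ?norm_mulmx_le ?hd.
Qed.

Lemma strict_diff_continuous m n (U : set 'rV[R]_m) (phi : 'rV[R]_m -> 'rV[R]_n)
    (D : 'rV[R]_m -> 'M[R]_(m, n)) :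
  (forall u, U u -> strict_diff U phi u (D u)) -> {within U, continuous phi}.
Proof.
move=> h; apply/subspace_continuousP => u Uu; apply/cvgrPdist_lt => e e0.
have [d d0 hd] := strict_diff_lipschitz (h u Uu).
have c0 : 0 < mx_sum_norm (D u) + 1 by rewrite ltr_wpDl ?mx_sum_norm_ge0.
have ud : \forall y \near u, ball u d y by exact: nbhsx_ballx.
have ue : \forall y \near u, ball u (e / (mx_sum_norm (D u) + 1)) y.
  by apply: nbhsx_ballx; rewrite divr_gt0.
near=> y; have Uy : U y by near: y; exact: withinT.
have uy : ball u d y by near: y; apply: cvg_within.
rewrite (le_lt_trans (hd _ _ Uu Uy (ballxx _ d0) uy))// mulrC -ltr_pdivlMr//.
have : ball u (e / (mx_sum_norm (D u) + 1)) y by near: y; apply: cvg_within.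
by rewrite -ball_normE.
Unshelve. all: by end_near. Qed.

End strict_differentiability.

(** * Distortion of measure near a point *)

Section local_distortion.
Context {R : realType} {n : nat}.
Notation lam := (lebesgue_rV n).

(** Composed with the inverse of D, the map is so close to the identity that it and its inverse are
    Lipschitz with constants 1 + e and (1 - e)^-1. Each constant yields one of the two bounds, and
    the linear map D contributes [|\det D|]. *)
Lemma strict_diff_distortion (U : set 'rV[R]_n) phi u (D : 'M[R]_n) (e : R) :
  D \in unitmx -> strict_diff U phi u D -> 0 < e < 1 ->
  exists2 d, 0 < d & forall K, compact K -> K `<=` U -> K `<=` ball u d ->
    (lam (phi @` K) <= ((1 + e) ^+ n * `|\det D|)%:E * lam K)%E /\
    (((1 - e) ^+ n * `|\det D|)%:E * lam K <= lam (phi @` K))%E.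
Proof.
move=> uD sd /andP[e0 e1].
(* C is positive and bounds the norm of [invmx D], so a tolerance e / C for [phi] becomes e for
   [psi]. *)
pose C := mx_sum_norm (invmx D) + 1.
have C0 : 0 < C by rewrite /C ltr_wpDl ?mx_sum_norm_ge0.
have [|d d0 hd] := sd (e / C); first by rewrite divr_gt0.
exists d => // K cK KU Ku.
pose psi x := phi x *m invmx D.
have psiE x y : K x -> K y -> `|(psi x - psi y) - (x - y)| <= e * `|x - y|.
  move=> Kx Ky.
  have -> : psi x - psi y - (x - y) = (phi x - phi y - (x - y) *m D) *m invmx D.
    by rewrite !mulmxBl !mulmxK.
  rewrite (le_trans (norm_mulmx_le _ _))//.
  apply: (@le_trans _ _ (C * (e / C * `|x - y|))).
    apply: ler_pM => //; first exact: mx_sum_norm_ge0.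
      by rewrite /C lerDl.
    by apply: hd; [exact: KU|exact: KU|exact: Ku|exact: Ku].
  by rewrite mulrA mulrCA divff ?gt_eqF// mulr1.
have psi_lip x y : K x -> K y -> `|psi x - psi y| <= (1 + e) * `|x - y|.
  move=> Kx Ky; rewrite -(subrK (x - y) (psi x - psi y)).
  by rewrite (le_trans (ler_normD _ _))// addrC mulrDl mul1r lerD2l psiE.
have psi_colip x y : K x -> K y -> `|x - y| <= (1 - e)^-1 * `|psi x - psi y|.
  move=> Kx Ky; rewrite ler_pdivlMl ?subr_gt0// mulrBl mul1r lerBlDr.
  rewrite -{1}(subrK (psi x - psi y) (x - y)) addrC (le_trans (ler_normD _ _))//.
  by rewrite lerD2l distrC psiE.
have cpsi : {within K, continuous psi} by exact: lipschitz_within_continuous psi_lip.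
have cpsiK : compact (psi @` K) by exact: continuous_compact.
have phiE : phi @` K = (fun x => x *m D) @` (psi @` K).
  by rewrite image_comp; apply: eq_imagel => x _; rewrite /= mulmxKV.
rewrite phiE lebesgue_rV_linear//; split.
  rewrite mulrC EFinM -muleA lee_wpmul2l ?lee_fin//.
  apply: lipschitz_image_le => //; first by rewrite addr_ge0// ltW.
  exact: compact_measurable_rV.
rewrite mulrC EFinM -muleA lee_wpmul2l ?lee_fin//.
(* For the lower bound, K is seen as the image of its [psi]-image under the inverse [g] of [psi],
   and the Lipschitz bound is applied to [g]. *)
have /choice[g gE] : forall y, exists x, (psi @` K) y -> K x /\ psi x = y.
  move=> y; have [[x Kx xy]|ny] := pselect ((psi @` K) y); last by exists 0.
  by exists x.
have KE : g @` (psi @` K) = K.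
  have gpsi x : K x -> g (psi x) = x.
    move=> Kx; have [|Kg gx] := gE (psi x); first by exists x.
    apply/eqP; rewrite -subr_eq0 -normr_eq0 eq_le normr_ge0 andbT.
    by rewrite (le_trans (psi_colip _ _ Kg Kx))// gx subrr normr0 mulr0.
  apply/seteqP; split=> [_ [_ [x Kx <-] <-]|x Kx]; first by rewrite gpsi.
  by exists (psi x); [exists x|exact: gpsi].
have e1' : 0 < 1 - e by rewrite subr_gt0.
have := @lipschitz_image_le R n (psi @` K) g (1 - e)^-1.
rewrite KE invr_ge0 => /(_ (ltW e1') cpsiK (compact_measurable_rV cK)) h.
have {}h : (lam K <= ((1 - e)^-1 ^+ n)%:E * lam (psi @` K))%E.
  apply: h => y y' Ky Ky'; have [Kg gy] := gE _ Ky; have [Kg' gy'] := gE _ Ky'.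
  by rewrite -{2}gy -{2}gy'; exact: psi_colip.
apply: le_trans (lee_wpmul2l _ h) _; first by rewrite lee_fin exprn_ge0// ltW.
by rewrite muleA -EFinM -exprMn divff ?gt_eqF// expr1n mul1e.
Qed.

(** The additive form of the error can be compared with the integral of a density that stays close
    to [|\det D|]. *)
Lemma strict_diff_distortion_add (U : set 'rV[R]_n) phi u (D : 'M[R]_n) (e : R) :
  D \in unitmx -> strict_diff U phi u D -> 0 < e ->
  exists2 d, 0 < d & forall K, compact K -> K `<=` U -> K `<=` ball u d ->
    (lam (phi @` K) <= (`|\det D| + e)%:E * lam K)%E /\
    ((`|\det D| - e)%:E * lam K <= lam (phi @` K))%E.
Proof.
move=> uD sd e0; set c := `|\det D|.
have cf : (fun t : R => (1 + t) ^+ n * c) @ 0 --> (1 + 0) ^+ n * c.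
  apply: cvgM; last exact: cvg_cst.
  apply: (cvg_comp (fun t : R => 1 + t) (fun t : R => t ^+ n)).
    by apply: cvgD; [exact: cvg_cst|exact: cvg_id].
  exact: exprn_continuous.
move/cvgrPdist_lt : cf => /(_ e e0)/nbhs_ballP[r /= r0 hr].
have h t : `|t| < r -> `|c - (1 + t) ^+ n * c| < e.
  move=> tr; have := hr t; rewrite addr0 expr1n mul1r; apply.
  by rewrite -ball_normE /ball_/= sub0r normrN.
(* Below r for the continuity estimate, used at t and at -t, and below 1 for
   [strict_diff_distortion]. *)
pose t := Num.min (r / 2) (1 / 2).
have t01 : 0 < t < 1.
  by rewrite lt_min gt_min; apply/andP; split; [rewrite !divr_gt0|apply/orP; right; lra].
have [t0 t1] := andP t01.
have tr : t < r by rewrite gt_min; apply/orP; left; lra.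
have [d d0 hd] := strict_diff_distortion uD sd t01.
exists d => // K cK KU Ku; have [h1 h2] := hd K cK KU Ku.
split.
  apply: le_trans h1 _; rewrite lee_wpmul2r// lee_fin.
  have := h t; rewrite gtr0_norm// => /(_ tr); rewrite ltr_norml.
  by rewrite -/c; lra.
apply: le_trans _ h2; rewrite lee_wpmul2r// lee_fin.
have := h (- t); rewrite normrN gtr0_norm// => /(_ tr); rewrite ltr_norml.
by rewrite -/c; lra.
Qed.

End local_distortion.

(** * From measures of compact images to integrals *)

Section change_of_variables.
Context {R : realType} {n : nat}.
Notation lam := (lebesgue_rV n).
Implicit Types (U K : set 'rV[R]_n) (phi : 'rV[R]_n -> 'rV[R]_n).

(** Continuity is asked of [|\det (D u)|], the density of the image measure, and not of D: in the
    application D is chosen point by point. *)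
Definition strict_embedding U phi (D : 'rV[R]_n -> 'M[R]_n) : Prop :=
  [/\ compact U,
      forall x y, U x -> U y -> phi x = phi y -> x = y,
      forall u, U u -> strict_diff U phi u (D u),
      forall u, U u -> D u \in unitmx &
      {within U, continuous (fun u => `|\det (D u)|)}].

Lemma strict_embeddingS U K phi D : compact K -> K `<=` U ->
  strict_embedding U phi D -> strict_embedding K phi D.
Proof.
move=> cK KU [cU inj sd uD cD]; split=> //.
- by move=> x y /KU Ux /KU; exact: inj.
- by move=> u /KU Uu; apply: strict_diffS KU _; exact: sd.
- by move=> u /KU; exact: uD.
- exact: continuous_subspaceW cD.
Qed.

Lemma strict_embedding_compact U phi D :
  strict_embedding U phi D -> compact (phi @` U).
Proof.
by move=> [cU _ sd _ _]; apply: continuous_compact => //; exact: strict_diff_continuous sd.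
Qed.

Section inverse.
Context {p : nat}.
Variables (U : set 'rV[R]_n) (F : 'rV[R]_n -> 'rV[R]_p).

(* Junk value 0 outside the image of U. *)
Definition inv_on (y : 'rV[R]_p) : 'rV[R]_n := xget 0 [set x | U x /\ F x = y].

Hypothesis F_inj : forall x y, U x -> U y -> F x = F y -> x = y.

Lemma inv_onK x : U x -> inv_on (F x) = x.
Proof.
move=> Ux; rewrite /inv_on; case: xgetP => [y _ [Uy yx]|]; first exact: F_inj.
by move=> /(_ x) /= /not_andP[].
Qed.

(** The preimage of a closed C is the image of the compact part of U inside C, together with the
    complement of the image of U when C contains the junk value 0. *)
Lemma measurable_inv_on : compact U -> {within U, continuous F} ->
  measurable_fun setT inv_on.
Proof.
move=> cU cF.
have cFC C : closed C -> compact (F @` (U `&` C)).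
  move=> cC; apply: continuous_compact; first exact: continuous_subspaceW cF.
  exact: compact_closedI.
apply: (measurability _ measurable_rVE) => _ [C cC <-]; rewrite setTI.
have -> : inv_on @^-1` C = F @` (U `&` C) `|` (~` (F @` U) `&` [set y | C 0]).
  apply/seteqP; split=> [y Cy|y [[x [Ux Cx] <-]|[ny C0]]].
  - have [[x Ux xy]|ny] := pselect ((F @` U) y).
      left; exists x => //; split=> //.
      by move: Cy; rewrite /= -xy inv_onK.
    right; split=> //; move: Cy; rewrite /= /inv_on xgetPN// => x [Ux xy].
    by apply: ny; exists x.
  - by rewrite /= inv_onK.
  - by rewrite /= /inv_on xgetPN// => x [Ux xy]; apply: ny; exists x.
apply: measurableU; first exact: compact_measurable_rV (cFC _ cC).
apply: measurableI.
  apply: measurableC; apply: compact_measurable_rV.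
  by rewrite -(setIT U); exact: cFC closedT.
have [C0|C0] := pselect (C 0).
  by rewrite (_ : [set _ | _] = setT)//; apply/seteqP; split.
by rewrite (_ : [set _ | _] = set0)//; apply/seteqP; split.
Qed.

End inverse.

Section embedding.
Variables (U : set 'rV[R]_n) (phi : 'rV[R]_n -> 'rV[R]_n) (D : 'rV[R]_n -> 'M[R]_n).
Hypothesis emb : strict_embedding U phi D.

(** Cut off to 0 outside U because [mdensity] takes a density measurable on the whole space. *)
Definition jacobian_factor : 'rV[R]_n -> R := (fun u => `|\det (D u)|) \_ U.

Let cU : compact U. Proof. by case: emb. Qed.
Let clU : closed U. Proof. exact: (compact_closed (@norm_hausdorff _ _) cU). Qed.
Let mU : measurable U. Proof. exact: compact_measurable_rV cU. Qed.

Lemma jacobian_factor_ge0 u : 0 <= jacobian_factor u.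
Proof. by rewrite /jacobian_factor patchE; case: ifP. Qed.

Lemma measurable_jacobian_factor :
  measurable_fun setT (jacobian_factor : _ -> measurableTypeR R).
Proof.
have mJ : measurable_fun U (fun u => `|\det (D u)| : measurableTypeR R).
  by apply: within_continuous_measurable => //; case: emb.
move/(measurable_restrictT _ mU) : mJ => mJ.
exact: mJ.
Qed.

Let J_meas : {measure set 'rV[R]_n -> \bar R} :=
  mdensity lam measurable_jacobian_factor jacobian_factor_ge0.

Let mV : measurable (phi @` U).
Proof. exact: compact_measurable_rV (strict_embedding_compact emb). Qed.

Let minv : measurable_fun setT (inv_on U phi).
Proof.
have [_ inj sd _ _] := emb; apply: measurable_inv_on => //.
exact: strict_diff_continuous sd.
Qed.

(** Sends a part of U to the measure of its image; as a pushforward under the inverse of [phi] it is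
    a measure by construction. *)
Let img_meas : {measure set 'rV[R]_n -> \bar R} :=
  measure_function_pushforward__canonical__measure_function_Measure
    (mrestr lam mV) minv.

Let img_measE K : K `<=` U -> img_meas K = lam (phi @` K).
Proof.
move=> KU; have [_ inj _ _ _] := emb.
rewrite /img_meas /= /pushforward /mrestr; congr (lam _).
apply/seteqP; split=> [y [Ky [x Ux xy]]|_ [x Kx <-]].
  by move: Ky; rewrite /= -xy inv_onK// => Kx; exists x.
by split; [rewrite /= inv_onK//; exact: KU|exists x => //; exact: KU].
Qed.

(** Near u both quantities lie within e / 2 times [lam K] of [|\det (D u)|] times [lam K]: one by
    the distortion estimate, the other by continuity of the density. *)
Lemma local_change_of_variables u e : U u -> 0 < e ->
  exists2 d, 0 < d & forall K, compact K -> K `<=` U -> K `<=` ball u d ->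
    (lam (phi @` K) <= J_meas K + e%:E * lam K)%E /\
    (J_meas K <= lam (phi @` K) + e%:E * lam K)%E.
Proof.
move=> Uu e0; have [_ _ sd uD cD] := emb.
have e20 : 0 < e / 2 by rewrite divr_gt0.
have [d1 d10 h1] := strict_diff_distortion_add (uD u Uu) (sd u Uu) e20.
have : \forall x \near u, U x -> `| `|\det (D u)| - `|\det (D x)| | < e / 2.
  by move/subspace_continuousP : cD => /(_ u Uu)/cvgrPdist_lt/(_ _ e20).
move=> /nbhs_ballP[d2 /= d20 h2].
exists (Num.min d1 d2); first by rewrite lt_min d10.
move=> K cK KU Ku; have mK := compact_measurable_rV cK.
have [|l1 l2] := h1 K cK KU.
  by move=> x /Ku; apply: le_ball; rewrite ge_min lexx.
have JK x : K x -> `|\det (D u)| - e / 2 <= jacobian_factor x <= `|\det (D u)| + e / 2.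
  move=> Kx; rewrite /jacobian_factor patchE mem_set; last exact: KU.
  have /h2 : ball u d2 x by apply: le_ball (Ku x Kx); rewrite ge_min lexx orbT.
  by move=> /(_ (KU _ Kx)); rewrite ltr_norml; lra.
have mJ : measurable_fun K (EFin \o jacobian_factor).
  by apply/measurable_EFinP/measurable_funTS; exact: measurable_jacobian_factor.
have Jlow : (`|\det (D u)|%:E * lam K <= J_meas K + (e / 2)%:E * lam K)%E.
  rewrite -!integral_cst// /J_meas /= /mdensity -ge0_integralD//; last 2 first.
  - by move=> x _; rewrite lee_fin jacobian_factor_ge0.
  - by move=> x _; rewrite lee_fin ltW.
  apply: ge0_le_integral => //.
  - by apply: emeasurable_funD.
  - by move=> x /JK/andP[+ _]; rewrite -EFinD lee_fin lerBlDr.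
have Jup : (J_meas K <= (`|\det (D u)| + e / 2)%:E * lam K)%E.
  rewrite -integral_cst// /J_meas /= /mdensity.
  apply: ge0_le_integral => //.
  - by move=> x _; rewrite lee_fin jacobian_factor_ge0.
  - by move=> x /JK/andP[_]; rewrite lee_fin.
have finK := compact_lebesgue_fin cK.
have K0 : (0 <= lam K)%E by [].
have I0 : (0 <= lam (phi @` K))%E by [].
have J0 : (0 <= J_meas K)%E by [].
move: K0 I0 J0 finK l1 l2 Jlow Jup.
case: (lam K) => [k||]// K0; case: (lam (phi @` K)) => [i||]// I0.
case jE : (J_meas K) => [j||]// J0 _; rewrite -!EFinM -!EFinD !lee_fin.
move=> l1 l2 Jlow Jup; clear K0 I0 J0; split.
  by rewrite [X in (_ <= X + _)%E]jE lee_fin; lra.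
by rewrite [X in (X <= _)%E]jE lee_fin; lra.
Qed.

(** The error e times [lam] is itself a measure on U, so the local estimates globalize by
    [le_measure_of_local]; then e tends to 0, as [lam U] is finite. *)
Lemma compact_change_of_variables : lam (phi @` U) = J_meas U.
Proof.
pose mUm := mrestr lam mU.
have lamU_fin := compact_lebesgue_fin cU.
have mUE K : K `<=` U -> mUm K = lam K.
  by move=> KU; rewrite /mUm /mrestr setIidl.
have img_U : img_meas U = lam (phi @` U) by exact: img_measE.
have approx (x y : \bar R) :
    (forall e : R, 0 < e -> (x <= y + e%:E * lam U)%E) -> (x <= y)%E.
  move=> h; apply/lee_addgt0Pr => e e0.
  move: lamU_fin h; have : (0 <= lam U)%E by [].
  (* The denominator is k + 1 since U may have measure 0. *)
  case: (lam U) => [k||]// k0 _ /(_ (e / (k + 1))); rewrite divr_gt0 ?ltr_wpDl//.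
  move=> /(_ isT)/le_trans; apply; rewrite leeD2l// -EFinM lee_fin.
  rewrite lee_fin in k0.
  by rewrite mulrAC ler_pdivrMr ?ltr_wpDl// ler_wpM2l ?(ltW e0)// lerDl.
apply/eqP; rewrite eq_le; apply/andP; split; apply: approx => e e0.
- pose r : {measure set _ -> \bar R} := measure_add J_meas (mscale (NngNum (ltW e0)) mUm).
  have rE K : K `<=` U -> r K = (J_meas K + e%:E * lam K)%E.
    move=> KU; rewrite [LHS](measure_addE J_meas (mscale (NngNum (ltW e0)) mUm)).
    by rewrite -(mUE _ KU).
  rewrite -img_U -rE//; apply: le_measure_of_local => // u Uu.
  have [d d0 hd] := local_change_of_variables Uu e0.
  exists d => // K cK KU Ku; have [h _] := hd K cK KU Ku.
  by rewrite rE// img_measE.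
- pose r : {measure set _ -> \bar R} := measure_add img_meas (mscale (NngNum (ltW e0)) mUm).
  have rE K : K `<=` U -> r K = (lam (phi @` K) + e%:E * lam K)%E.
    move=> KU; rewrite [LHS](measure_addE img_meas (mscale (NngNum (ltW e0)) mUm)).
    by rewrite -(mUE _ KU) -img_measE.
  rewrite -rE//; apply: le_measure_of_local => // u Uu.
  have [d d0 hd] := local_change_of_variables Uu e0.
  exists d => // K cK KU Ku; have [_ h] := hd K cK KU Ku.
  by rewrite rE//.
Qed.

End embedding.

Lemma lebesgue_image U phi D : strict_embedding U phi D ->
  (lam (phi @` U) = \int[lam]_(u in U) `|\det (D u)|%:E)%E.
Proof.
move=> emb; rewrite (compact_change_of_variables emb).
by apply: eq_integral => u Uu; rewrite /jacobian_factor patchE Uu.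
Qed.

(** The case of compact sets says that two finite measures agree on closed sets: [lam] restricted to
    the image, and the pushforward under [phi] of the measure with density [|\det (D u)|] on U.
    Hence they are equal, and g has the same integral against both. *)
Theorem ge0_change_of_variables U phi D (g : 'rV[R]_n -> \bar R) :
  strict_embedding U phi D -> measurable_fun (phi @` U) g ->
  (forall y, (phi @` U) y -> (0 <= g y)%E) ->
  (\int[lam]_(y in phi @` U) g y =
   \int[lam]_(u in U) (g (phi u) * `|\det (D u)|%:E))%E.
Proof.
move=> emb mg g0; have [cU inj sd _ _] := emb.
have clU := compact_closed (@norm_hausdorff _ _) cU.
have mU := compact_measurable_rV cU.
have cV := strict_embedding_compact emb.
have mV := compact_measurable_rV cV.
(* [phi] is cut off to 0 outside U to be measurable everywhere; the density vanishes there, so this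
   value carries no mass. *)
have mphi : measurable_fun setT (phi \_ U).
  have : measurable_fun U phi.
    apply: within_continuous_measurable_rV => //.
    exact: strict_diff_continuous sd.
  by move/(measurable_restrictT _ mU).
pose J := jacobian_factor U D.
have JE u : U u -> J u = `|\det (D u)| by move=> Uu; rewrite /J /jacobian_factor patchE mem_set.
have phiE u : U u -> (phi \_ U) u = phi u by move=> Uu; rewrite patchE mem_set.
pose Jm : {measure set 'rV[R]_n -> \bar R} :=
  mdensity lam (measurable_jacobian_factor emb) (@jacobian_factor_ge0 U D).
pose m1 : {measure set 'rV[R]_n -> \bar R} :=
  measure_function_pushforward__canonical__measure_function_Measure Jm mphi.
have m12 B : measurable B -> mrestr lam mV B = m1 B.
  apply: (@measure_unique _ R _ [set A : set 'rV[R]_n | closed A] (fun _ => setT)).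
  - exact: measurable_rVE.
  - by move=> A C; exact: closedI.
  - by move=> _; exact: closedT.
  - by rewrite bigcup_const.
  (* The part of U sent into A is compact, so [lebesgue_image] applies to the restriction of [phi]
     to it. *)
  - move=> A cA.
    have embA : strict_embedding (U `&` phi @^-1` A) phi D.
      apply: (strict_embeddingS _ _ emb); last by move=> x [].
      apply: (subclosed_compact _ cU); last by move=> x [].
      rewrite closed_setSI//.
      by have /continuous_closedP := strict_diff_continuous sd; apply.
    transitivity (lam (phi @` (U `&` phi @^-1` A))).
      rewrite /= /mrestr; congr (lam _); apply/seteqP.
      split=> [y [Ay [x Ux xy]]|_ [x [Ux Ax] <-]]; last by split=> //; exists x.
      by exists x => //; split=> //=; rewrite xy.
    rewrite (lebesgue_image embA).
    rewrite -[RHS]/(\int[lam]_(u in (phi \_ U) @^-1` A) (J u)%:E)%E.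
    rewrite integral_mkcond [RHS]integral_mkcond; apply: eq_integral => u _.
    rewrite !patchE; have [Uu|nUu] := pselect (U u).
      have -> : (u \in U `&` phi @^-1` A) = (u \in (phi \_ U) @^-1` A).
        apply/idP/idP => /set_mem h; apply/mem_set; last first.
          by split=> //; move: h; rewrite /preimage/= phiE.
        by case: h => _; rewrite /preimage/= phiE.
      by case: ifP => //; rewrite JE.
    rewrite memNset; last by case.
    by case: ifP => // _; rewrite /J /jacobian_factor patchE memNset.
  - move=> _; rewrite /= /mrestr setTI; exact: compact_lebesgue_fin.
rewrite (eq_measure_integral m1); last first.
  by move=> A mA AV; rewrite -m12// /mrestr setIidl.
rewrite (ge0_integral_pushforward mphi Jm mV mg); last first.
  by move=> y; rewrite inE; exact: g0.
have mUV : measurable ((phi \_ U) @^-1` (phi @` U)).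
  by rewrite -[X in measurable X]setTI; exact: (mphi measurableT _ mV).
rewrite ge0_integral_mdensity//; last first.
- by move=> x /g0.
- by apply: (measurable_comp mV) => //; [move=> _ [x Ux <-]|exact: measurable_funTS].
rewrite integral_mkcond [RHS]integral_mkcond; apply: eq_integral => u _.
rewrite !patchE; have [Uu|nUu] := pselect (U u).
  rewrite !mem_set//; last by rewrite /= phiE//; exists u.
  by rewrite /= phiE// -JE.
rewrite [in RHS]memNset//; case: ifP => // _.
by rewrite /jacobian_factor patchE memNset// mule0.
Qed.

End change_of_variables.

(** * Pseudo-determinant of the tangential gradient *)

Section pseudo_determinant.

(* Both sides are the determinant of [[X, A], [B, 1]] after clearing one
   off-diagonal block. *)
Lemma char_poly_mulC (F : fieldType) m n (A : 'M[F]_(m, n)) (B : 'M[F]_(n, m)) :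
  'X^n * char_poly (A *m B) = 'X^m * char_poly (B *m A).
Proof.
pose Ap := map_mx polyC A; pose Bp := map_mx polyC B.
pose M := block_mx ('X%:M : 'M[{poly F}]_m) Ap Bp (1%:M : 'M[{poly F}]_n).
have detM : \det M = char_poly (A *m B).
  have -> : char_poly (A *m B) = \det (block_mx 1%:M (- Ap) 0 1%:M *m M).
    rewrite mulmx_block !mul1mx !mul0mx !add0r mulmx1 subrr mulNmx det_lblock det1 mulr1.
    by rewrite /char_poly /char_poly_mx map_mxM.
  by rewrite det_mulmx det_ublock !det1 !mul1r.
have : \det (block_mx 1%:M 0 (- Bp) 'X%:M *m M) = 'X^n * \det M.
  by rewrite det_mulmx det_lblock det1 mul1r det_scalar.
rewrite detM => <-.
rewrite mulmx_block !mul1mx !mul0mx !addr0 mulmx1 !mulNmx mul_mx_scalar mul_scalar_mx addNr.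
rewrite det_ublock det_scalar; congr (_ * _).
by rewrite /char_poly /char_poly_mx map_mxM addrC.
Qed.

Context {R : realType}.

Lemma char_poly_eigenvalues n (A : 'M[R]_n) :
  char_poly (map_mx (real_complex R) A) = \prod_(z <- eigenvalues A) ('X - z%:P).
Proof.
rewrite /eigenvalues; case: closed_field_poly_normal => r /= rE.
by rewrite [LHS]rE (monicP (char_poly_monic _)) scale1r.
Qed.

(** By [char_poly_mulC] the two lists of eigenvalues agree once padded with zeros, and zeros do not
    enter the pseudo-determinant. *)
Lemma pseudo_det_mulC m n (A : 'M[R]_(m, n)) (B : 'M[R]_(n, m)) :
  pseudo_det (A *m B) = pseudo_det (B *m A).
Proof.
have prod0 k : \prod_(z <- nseq k (0 : R[i])) ('X - z%:P) = 'X^k.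
  by rewrite big_nseq iter_mulr_1 subr0.
have E : perm_eq (nseq n (0 : R[i]) ++ eigenvalues (A *m B))
                 (nseq m (0 : R[i]) ++ eigenvalues (B *m A)).
  apply: prod_XsubC_eq; rewrite !big_cat /= !prod0 -!char_poly_eigenvalues.
  by rewrite !map_mxM char_poly_mulC.
have pE k (r : seq R[i]) :
    \prod_(z <- nseq k 0 ++ r | z != 0) z = \prod_(z <- r | z != 0) z.
  rewrite big_cat /= big1_seq ?mul1r// => z /andP[z0].
  by rewrite mem_nseq => /andP[_ /eqP zE]; rewrite zE eqxx in z0.
by rewrite /pseudo_det -(pE n) -(pE m) (perm_big _ E).
Qed.

Lemma mulmx_trE n (v : 'rV[R]_n) : (v *m v^T) 0 0 = \sum_i v 0 i ^+ 2.
Proof. by rewrite mxE; apply: eq_bigr => i _; rewrite mxE expr2. Qed.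

Lemma mulmx_tr_gt0 n (v : 'rV[R]_n) : v != 0 -> 0 < (v *m v^T) 0 0.
Proof.
move=> v0; rewrite lt_def mulmx_trE sumr_ge0 ?andbT; last by move=> i _; exact: sqr_ge0.
apply: contra v0 => /eqP /psumr_eq0P h; apply/eqP/rowP => i; rewrite mxE.
by apply/eqP; rewrite -sqrf_eq0 h// => j _; exact: sqr_ge0.
Qed.

(* The segment from the identity to the Gram matrix consists of positive
   definite matrices, so the determinant cannot change sign along it. *)
Lemma gram_det_gt0 m n (J : 'M[R]_(m, n)) :
  \det (J^T *m J) != 0 -> 0 < \det (J^T *m J).
Proof.
move=> g0; set g := J^T *m J; rewrite lt_def g0 /= leNgt; apply/negP => gneg.
pose q : {poly R} := \det ((1 - 'X)%:M + 'X *: map_mx polyC g).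
have qE t : q.[t] = \det ((1 - t)%:M + t *: g).
  rewrite -horner_evalE -det_map_mx; congr (\det _); apply/matrixP => i j.
  rewrite !mxE /= horner_evalE hornerD hornerM hornerX hornerC hornerMn.
  by rewrite hornerD hornerN hornerX hornerC.
have [||t /andP[t0 t1] /rootP] := @poly_ivt R (- q) 0 1; first exact: ler01.
  by rewrite !hornerN !qE subr0 scale0r addr0 det1 subrr scale1r raddf0 add0r
    oppr_le0 ler01 oppr_ge0 ltW.
rewrite hornerN qE => /eqP; rewrite oppr_eq0 => /det0P[v v0 vM].
have [t1'|t1'] := eqVneq t 1.
  move: vM; rewrite t1' subrr raddf0 add0r scale1r => vg.
  by move/negP: g0; apply; apply/det0P; exists v.
have : (v *m ((1 - t)%:M + t *: g) *m v^T) 0 0 = 0 by rewrite vM mul0mx mxE.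
have w0 : 0 <= ((v *m J^T) *m (v *m J^T)^T) 0 0.
  by rewrite mulmx_trE; apply: sumr_ge0 => i _; exact: sqr_ge0.
have := mulmx_tr_gt0 v0.
have -> : v *m ((1 - t)%:M + t *: g) *m v^T =
    (1 - t) *: (v *m v^T) + t *: ((v *m J^T) *m (v *m J^T)^T).
  rewrite mulmxDr mulmxDl mul_mx_scalar -scalemxAl -scalemxAr -scalemxAl.
  by rewrite trmx_mul trmxK /g !mulmxA.
have -> (P Q : 'M[R]_1) : ((1 - t) *: P + t *: Q) 0 0 = (1 - t) * P 0 0 + t * Q 0 0.
  by rewrite !mxE.
move=> v1 e.
have : 0 < (1 - t) * (v *m v^T) 0 0 by rewrite mulr_gt0// subr_gt0 lt_neqAle t1'.
have : 0 <= t * ((v *m J^T) *m (v *m J^T)^T) 0 0 by rewrite mulr_ge0.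
by move: e; lra.
Qed.

(** The first and third Penrose equations force [J^T *m J *m X = J^T], hence the value of X. The
    formula is then checked against all four, since [xget] would return 0 if there were no
    solution. *)
Lemma mp_inverseE m n (J : 'M[R]_(m, n)) : J^T *m J \in unitmx ->
  mp_inverse J = invmx (J^T *m J) *m J^T.
Proof.
set g := J^T *m J => ug; rewrite /mp_inverse.
have gT : g^T = g by rewrite /g trmx_mul trmxK.
case: xgetP => [X _ /= [JXJ _ JXT _]|].
  have gX : g *m X = J^T.
    by rewrite /g -mulmxA -JXT -trmx_mul JXJ.
  by rewrite -gX mulKmx.
move=> /(_ (invmx g *m J^T)) /=; case; split.
- by rewrite -!mulmxA -/g mulVmx ?mulmx1.
- by rewrite -(mulmxA _ J^T) -/g mulVmx// mul1mx.
- by rewrite !trmx_mul trmxK trmx_inv gT mulmxA.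
- by rewrite -mulmxA -/g mulVmx// trmx1.
Qed.

(** With P the Moore-Penrose inverse of J, [P *m P^T] is the inverse of the Gram matrix of J. Moving
    [P^T] to the other end replaces a possibly singular m x m matrix by an invertible n x n one,
    whose pseudo-determinant is its determinant. *)
Lemma Det_mul_mp_inverse m n p (J : 'M[R]_(m, n)) (K : 'M[R]_(p, n)) (G : 'M[R]_n) :
  \det (J^T *m J) != 0 -> \det (K^T *m K) != 0 -> 0 < \det G ->
  Det (K *m G *m mp_inverse J) =
  \det G * Num.sqrt (\det (K^T *m K)) / Num.sqrt (\det (J^T *m J)).
Proof.
move=> gJ0 gK0 G0; have gJ := gram_det_gt0 gJ0; have gK := gram_det_gt0 gK0.
have uJ : J^T *m J \in unitmx by rewrite unitmxE unitfE.
rewrite /Det mp_inverseE//; set g := J^T *m J in uJ gJ *; set F := K *m G.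
have gT : g^T = g by rewrite /g trmx_mul trmxK.
set P := invmx g *m J^T.
have PPT : P *m P^T = invmx g.
  by rewrite /P trmx_mul trmxK trmx_inv gT -mulmxA (mulmxA J^T) -/g mulmxV// mulmx1.
have -> : pseudo_det ((F *m P)^T *m (F *m P)) = pseudo_det (F^T *m F *m invmx g).
  by rewrite trmx_mul -(mulmxA P^T) (pseudo_det_mulC P^T) (mulmxA F^T) -(mulmxA _ P) PPT.
have FE : F^T *m F = G^T *m (K^T *m K) *m G by rewrite /F trmx_mul !mulmxA.
have detE : \det (F^T *m F *m invmx g) = \det G ^+ 2 * \det (K^T *m K) / \det g.
  by rewrite FE !det_mulmx det_tr det_inv; ring.
rewrite pseudo_det_unitmx; last first.
  by rewrite unitmxE detE unitfE mulf_neq0 ?invr_neq0 ?mulf_neq0 ?expf_neq0 ?gt_eqF.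
rewrite detE /= sqrtrM ?sqrtrV ?mulr_ge0 ?sqr_ge0 ?ltW//; congr (_ / _).
by rewrite sqrtrM ?sqr_ge0// sqrtr_sqr gtr0_norm.
Qed.

End pseudo_determinant.

(** * Strict differentiability of C^1 maps *)

Section matrix_limits.
Context {R : realType} {T : Type} {F : set_system T} {FF : Filter F}.

Lemma cvg_mx_coord m n (A : T -> 'M[R]_(m, n)) (A0 : 'M[R]_(m, n)) i j :
  A x @[x --> F] --> A0 -> A x i j @[x --> F] --> A0 i j.
Proof. by move=> h; apply: (cvg_comp A (fun M => M i j) h); exact: coord_continuous. Qed.

Lemma cvg_mulmx m n p (A : T -> 'M[R]_(m, n)) (B : T -> 'M[R]_(n, p))
    (A0 : 'M[R]_(m, n)) (B0 : 'M[R]_(n, p)) :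
  A x @[x --> F] --> A0 -> B x @[x --> F] --> B0 ->
  A x *m B x @[x --> F] --> A0 *m B0.
Proof.
move=> hA hB; apply: cvg_mx => i j.
under eq_fun do rewrite mxE.
rewrite mxE; apply: cvg_big; first exact: add_continuous.
move=> k _.
by apply: cvgM; exact: cvg_mx_coord.
Qed.

Lemma cvg_trmx m n (A : T -> 'M[R]_(m, n)) (A0 : 'M[R]_(m, n)) :
  A x @[x --> F] --> A0 -> (A x)^T @[x --> F] --> A0^T.
Proof.
move=> hA; apply: cvg_mx => i j; under eq_fun do rewrite mxE.
by rewrite mxE; exact: cvg_mx_coord.
Qed.

Lemma cvg_det n (A : T -> 'M[R]_n) (A0 : 'M[R]_n) :
  A x @[x --> F] --> A0 -> \det (A x) @[x --> F] --> \det A0.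
Proof.
move=> hA; apply: cvg_big; first exact: add_continuous.
move=> s _; apply: cvgM; first exact: cvg_cst.
apply: cvg_big; first exact: mul_continuous.
move=> i _; exact: cvg_mx_coord.
Qed.

Lemma cvg_mx_sum_norm0 m n (A : T -> 'M[R]_(m, n)) (A0 : 'M[R]_(m, n)) :
  A x @[x --> F] --> A0 -> mx_sum_norm (A x - A0) @[x --> F] --> (0 : R).
Proof.
move=> hA; have -> : (0 : R) = mx_sum_norm (A0 - A0).
  by rewrite subrr /mx_sum_norm big1// => i _; rewrite big1// => j _; rewrite mxE normr0.
apply: cvg_big; first exact: add_continuous.
move=> i _; apply: cvg_big; first exact: add_continuous.
move=> j _; apply: cvg_norm; rewrite mxE [X in _ + X]mxE.
under eq_fun do rewrite mxE [X in _ + X]mxE.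
by apply: cvgB; [exact: cvg_mx_coord|exact: cvg_cst].
Qed.

End matrix_limits.

Section C1_maps.
Context {R : realType}.

Lemma jacobian_entry m n (F : 'rV[R]_m -> 'rV[R]_n) z i j :
  differentiable F z -> ('J F z) i j = ('D_(delta_mx 0 i) F z) 0 j.
Proof. by move=> dF; rewrite deriveEjacobian// -rowE [RHS]mxE. Qed.

(** [is_Ck] controls directional derivatives; along the basis vectors they are the rows of the
    Jacobian. *)
Lemma C1_jacobian_cvg m n (O : set 'rV[R]_m) (F : 'rV[R]_m -> 'rV[R]_n) u :
  open O -> is_Ck 1 O F -> O u -> 'J F z @[z --> u] --> 'J F u.
Proof.
move=> oO [dF cF] Ou; apply: (@cvg_mx _ _ (nbhs u) (nbhs_filter u)) => i j.
have E : \forall z \near u, ('D_(delta_mx 0 i) F z) 0 j = ('J F z) i j.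
  have : \forall z \near u, O z by apply: open_nbhs_nbhs; split.
  by apply: filterS => z Oz; rewrite jacobian_entry//; exact: dF.
have := @cvg_mx_coord R _ (nbhs u) 1 n (fun z => 'D_(delta_mx 0 i) F z) _ 0 j
  (cF (delta_mx 0 i) u Ou).
rewrite -(jacobian_entry i j (dF u Ou)).
exact: cvg_trans (near_eq_cvg E).
Qed.

Lemma is_derive_line n (f : 'rV[R]_n -> R) (y v : 'rV[R]_n) (t df : R) :
  is_derive (y + t *: v) v f df -> is_derive t 1 (fun s : R => f (y + s *: v)) df.
Proof.
have E : (fun h : R => h^-1 *: (((fun s : R => f (y + s *: v)) \o shift t) (h *: 1)
             - f (y + t *: v))) =
         (fun h : R => h^-1 *: ((f \o shift (y + t *: v)) (h *: v) - f (y + t *: v))).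
  apply/funext => h /=; congr (_ *: (f _ - _)).
  by rewrite [h *: 1]mulr1 scalerDl addrCA.
by move=> [d <-]; split; rewrite /derivable /derive E.
Qed.

Lemma ball_convex n (u x y : 'rV[R]_n) (d t : R) : 0 <= t <= 1 ->
  ball u d x -> ball u d y -> ball u d (y + t *: (x - y)).
Proof.
rewrite -ball_normE /ball_/= => /andP[t0 t1] ux uy.
have -> : u - (y + t *: (x - y)) = (1 - t) *: (u - y) + t *: (u - x).
  by apply/rowP => i; rewrite !mxE; ring.
rewrite (le_lt_trans (ler_normD _ _))// !normrZ ger0_norm ?subr_ge0// (ger0_norm t0).
apply: (@le_lt_trans _ _ (Num.max `|u - x| `|u - y|)); last by rewrite gt_max ux.
set r := Num.max _ _; apply: (@le_trans _ _ ((1 - t) * r + t * r)).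
  by rewrite lerD// ler_wpM2l ?subr_ge0// le_max lexx ?orbT.
by rewrite -mulrDl subrK mul1r.
Qed.

(** The scalar mean value theorem is applied to each coordinate with its own intermediate point,
    which is enough for the sup norm. *)
Lemma mean_value_ineq m n (F : 'rV[R]_m -> 'rV[R]_n) (DF : 'rV[R]_m -> 'M[R]_(m, n))
    (A : 'M[R]_(m, n)) x y e : 0 <= e ->
  (forall t, 0 <= t <= 1 -> is_derive (y + t *: (x - y)) (x - y) F
     ((x - y) *m DF (y + t *: (x - y)))) ->
  (forall t, 0 <= t <= 1 -> mx_sum_norm (DF (y + t *: (x - y)) - A) <= e) ->
  `|F x - F y - (x - y) *m A| <= e * `|x - y|.
Proof.
move=> e0 dF DFA; rewrite ler_rV_norm; last by rewrite mulr_ge0.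
apply/forallP => j; set v := x - y in dF DFA *.
have der (t : R) : t \in `[0, 1] ->
    is_derive t 1 (fun s : R => F (y + s *: v) 0 j) ((v *m DF (y + t *: v)) 0 j).
  rewrite in_itv/= => t01; apply: (@is_derive_line _ (fun z => F z 0 j)).
  have [dz <-] := dF t t01.
  split; first by move/derivable_mxP : dz => /(_ 0 j).
  by rewrite (derive_mx dz) mxE.
pose g (s : R) : R := F (y + s *: v) 0 j.
pose dg (t : R) : R := (v *m DF (y + t *: v)) 0 j.
have gd (t : R) : t \in `]0, 1[%R -> is_derive t 1 g (dg t).
  by move=> t01; apply: der; exact: subset_itv_oo_cc t01.
have cg : {within `[0, 1], continuous g}.
  by apply: derivable_within_continuous => t /der[].
have [c c01] := MVT_segment (@ler01 R) gd cg.
rewrite /g /dg.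
have yv : y + v = x by rewrite /v addrC subrK.
rewrite scale1r scale0r addr0 subr0 mulr1 yv => cE.
have -> : (F x - F y - v *m A) 0 j = (v *m (DF (y + c *: v) - A)) 0 j.
  by rewrite mulmxBr [LHS]mxE [RHS]mxE -cE [X in X + _]mxE [X in _ + X + _]mxE.
rewrite (le_trans (rV_coord_le_norm _ _))// (le_trans (norm_mulmx_le _ _))//.
by rewrite ler_wpM2r// DFA//; move: c01; rewrite in_itv.
Qed.

(** Points of a small ball around u are joined by a segment inside the ball, hence inside O, along
    which the Jacobian stays close to its value at u. *)
Lemma C1_strict_diff m n (O : set 'rV[R]_m) (F : 'rV[R]_m -> 'rV[R]_n) u :
  open O -> is_Ck 1 O F -> O u -> strict_diff O F u ('J F u).
Proof.
move=> oO CF Ou e e0; have [dF _] := CF.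
have JFu := C1_jacobian_cvg oO CF Ou.
have h1 : \forall z \near u, `|mx_sum_norm (jacobian F z - jacobian F u)| < e.
  exact: ((cvgr0Pnorm_lt _).1 (cvg_mx_sum_norm0 JFu) e e0).
have h2 : \forall z \near u, O z by apply: open_nbhs_nbhs; split.
have h12 : nbhs u (fun z => `|mx_sum_norm (jacobian F z - jacobian F u)| < e /\ O z).
  exact: filterI h1 h2.
move/nbhs_ballP : h12 => [d /= d0 hd].
exists d => // x y _ _ ux uy.
apply: (mean_value_ineq (DF := jacobian F)); first exact: ltW.
  move=> t t01; have [_ Oz] := hd _ (ball_convex t01 ux uy).
  by split; [apply: diff_derivable; exact: dF|rewrite deriveEjacobian//; exact: dF].
move=> t t01; have [+ _] := hd _ (ball_convex t01 ux uy).
by rewrite ger0_norm ?mx_sum_norm_ge0// => /ltW.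
Qed.

Lemma strict_diff_comp m n p (U : set 'rV[R]_m) (V : set 'rV[R]_n)
    (F : 'rV[R]_m -> 'rV[R]_n) (G : 'rV[R]_n -> 'rV[R]_p) u A B :
  U u -> (forall x, U x -> V (F x)) ->
  strict_diff U F u A -> strict_diff V G (F u) B ->
  strict_diff U (G \o F) u (A *m B).
Proof.
move=> Uu UV dF dG e e0.
pose a := mx_sum_norm A + 1; pose b := mx_sum_norm B + 1.
have a0 : 0 < a by rewrite ltr_wpDl ?mx_sum_norm_ge0.
have b0 : 0 < b by rewrite ltr_wpDl ?mx_sum_norm_ge0.
(* Half of e goes to each remainder: that of F is multiplied by B, at a cost b, and that of G is
   proportional to the increment of F, at a cost a. *)
have [|d1 d10 h1] := dF (e / (2 * b)); first by rewrite divr_gt0// mulr_gt0.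
have [|d2 d20 h2] := dG (e / (2 * a)); first by rewrite divr_gt0// mulr_gt0.
have [d3 d30 h3] := strict_diff_lipschitz dF.
pose d := Num.min (Num.min d1 d3) (d2 / a).
have d0 : 0 < d by rewrite !lt_min d10 d30 divr_gt0.
exists d => // x y Ux Uy ux uy.
have ball1 z : ball u d z -> ball u d1 z by apply: le_ball; rewrite !ge_min lexx.
have ball3 z : ball u d z -> ball u d3 z by apply: le_ball; rewrite !ge_min lexx orbT.
have ball2 z : U z -> ball u d z -> ball (F u) d2 (F z).
  move=> Uz uz; rewrite -ball_normE /ball_/=.
  apply: (le_lt_trans (h3 _ _ Uu Uz (ballxx _ d30) (ball3 _ uz))).
  rewrite mulrC -ltr_pdivlMr//; have : ball u (d2 / a) z.
    by apply: le_ball uz; rewrite !ge_min lexx !orbT.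
  by rewrite -ball_normE.
have := h2 _ _ (UV _ Ux) (UV _ Uy) (ball2 _ Ux ux) (ball2 _ Uy uy).
have := h1 _ _ Ux Uy (ball1 _ ux) (ball1 _ uy).
have := h3 _ _ Ux Uy (ball3 _ ux) (ball3 _ uy).
rewrite -/a => l3 l1 l2.
have -> : (G \o F) x - (G \o F) y - (x - y) *m (A *m B) =
    (G (F x) - G (F y) - (F x - F y) *m B) + (F x - F y - (x - y) *m A) *m B.
  by rewrite (mulmxBl (F x - F y)) mulmxA addrA subrK.
rewrite (le_trans (ler_normD _ _))// (splitr e) mulrDl lerD//.
  apply: (le_trans l2); apply: le_trans (ler_wpM2l _ l3) _.
    by rewrite divr_ge0 ?ltW// mulr_gt0.
  by rewrite mulrA ler_wpM2r// invfM mulrA mulfVK ?gt_eqF.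
apply: (le_trans (norm_mulmx_le _ _)).
apply: (@le_trans _ _ (b * (e / (2 * b) * `|x - y|))).
  by rewrite ler_pM ?mx_sum_norm_ge0// /b lerDl.
by rewrite (_ : b * _ = e / 2 * `|x - y|)//; field; rewrite gt_eqF.
Qed.

(** [phi] is only continuous and known through its composite with k. The right inverse P of B solves
    for its increment, but the remainder of k is measured by that same unknown increment, which has
    to be absorbed. *)
Lemma strict_diff_lift m n p (U : set 'rV[R]_m) (V : set 'rV[R]_n)
    (F : 'rV[R]_m -> 'rV[R]_p) (k : 'rV[R]_n -> 'rV[R]_p)
    (phi : 'rV[R]_m -> 'rV[R]_n) u (A : 'M[R]_(m, p)) B P (G : 'M[R]_(m, n)) :
  U u -> (forall x, U x -> V (phi x)) -> {within U, continuous phi} ->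
  (forall x, U x -> k (phi x) = F x) ->
  strict_diff U F u A -> strict_diff V k (phi u) B ->
  B *m P = 1%:M -> A = G *m B ->
  strict_diff U phi u G.
Proof.
move=> Uu UV cphi kphi dF dk BP AGB e e0.
pose c := mx_sum_norm P + 1; pose g := mx_sum_norm G.
have c0 : 0 < c by rewrite ltr_wpDl ?mx_sum_norm_ge0.
have g0 : 0 <= g by exact: mx_sum_norm_ge0.
(* Let r and q be the increments of the argument and of [phi]. The first bound gives
   [c * e1 <= 1 / 2], whence q is at most (2 g + 1) r; the second then makes the remainder, at most
   c e1 (r + q), at most e r. *)
pose e1 := Num.min (1 / (2 * c)) (e / (c * (2 * g + 2))).
have e10 : 0 < e1.
  by rewrite lt_min !divr_gt0 ?mulr_gt0// ltr_wpDl// mulr_ge0.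
have ce1 : c * e1 <= 1 / 2.
  rewrite mulrC -ler_pdivlMr// /e1 ge_min; apply/orP; left.
  by rewrite invfM mulrA.
have ce2 : c * e1 * (2 * g + 2) <= e.
  rewrite mulrAC mulrC -ler_pdivlMr; last by rewrite mulr_gt0// ltr_wpDl// mulr_ge0.
  by rewrite /e1 ge_min lexx orbT.
have [d1 d10 h1] := dF e1 e10.
have [d2 d20 h2] := dk e1 e10.
have /nbhs_ballP[d3 /= d30 h3] : \forall x \near u, U x -> ball (phi u) d2 (phi x).
  by move/subspace_continuousP : cphi => /(_ u Uu)/cvg_ballP/(_ _ d20).
exists (Num.min d1 d3); first by rewrite lt_min d10.
move=> x y Ux Uy ux uy.
have ball1 z : ball u (Num.min d1 d3) z -> ball u d1 z.
  by apply: le_ball; rewrite ge_min lexx.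
have ball3 z : ball u (Num.min d1 d3) z -> ball u d3 z.
  by apply: le_ball; rewrite ge_min lexx orbT.
have l1 := h1 _ _ Ux Uy (ball1 _ ux) (ball1 _ uy).
have l2 := h2 _ _ (UV _ Ux) (UV _ Uy) (h3 _ (ball3 _ ux) Ux) (h3 _ (ball3 _ uy) Uy).
rewrite !kphi// in l2.
have E : phi x - phi y - (x - y) *m G =
    (F x - F y - (x - y) *m A) *m P - (F x - F y - (phi x - phi y) *m B) *m P.
  have -> : G = A *m P by rewrite AGB -mulmxA BP mulmx1.
  rewrite -{1}[phi x - phi y]mulmx1 -BP !mulmxA -!mulmxBl; congr (_ *m P).
  by rewrite opprB [RHS]addrC addrA subrK.
have l3 : `|phi x - phi y - (x - y) *m G| <= c * e1 * (`|x - y| + `|phi x - phi y|).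
  rewrite E (le_trans (ler_normB _ _))// mulrDr lerD// -mulrA;
  by apply: (le_trans (norm_mulmx_le _ _)); rewrite ler_pM ?mx_sum_norm_ge0// /c lerDl.
have l4 : `|phi x - phi y| <= `|phi x - phi y - (x - y) *m G| + g * `|x - y|.
  rewrite -{1}(subrK ((x - y) *m G) (phi x - phi y)) (le_trans (ler_normD _ _))//.
  by rewrite lerD2l norm_mulmx_le.
have xy0 : 0 <= `|x - y| by [].
have phi0 : 0 <= `|phi x - phi y| by [].
have ce0 : 0 <= c * e1 by rewrite mulr_ge0 ?ltW.
move: (`|phi x - phi y|) (`|x - y|) (`|phi x - phi y - _|) l3 l4 xy0 phi0 => q r s.
move=> l3 l4 r0 q0.
have q2 : q <= (2 * g + 1) * r.
  have : c * e1 * (r + q) <= 1 / 2 * (r + q) by rewrite ler_wpM2r// addr_ge0.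
  by lra.
apply: (le_trans l3); apply: (@le_trans _ _ (c * e1 * ((2 * g + 2) * r))).
  by rewrite ler_wpM2l//; lra.
by rewrite mulrA ler_wpM2r.
Qed.

Lemma jacobian_comp m n p (F : 'rV[R]_m -> 'rV[R]_n) (G : 'rV[R]_n -> 'rV[R]_p) u :
  differentiable F u -> differentiable G (F u) ->
  'J (G \o F) u = 'J F u *m 'J G (F u).
Proof.
move=> dF dG; apply/row_matrixP => i; rewrite !rowE -deriveEjacobian; last first.
  exact: differentiable_comp.
rewrite deriveE; last exact: differentiable_comp.
by rewrite diff_comp//= mulmxA -deriveEjacobian// deriveE// -deriveEjacobian// deriveE.
Qed.

End C1_maps.

(** * The bound on the energy and its equality case *)

Section quadratic_energy.
Context d (T : measurableType d) (R : realType) (mu : {measure set T -> \bar R}).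
Local Open Scope ereal_scope.

Lemma measurable_funV_pos (D : set T) (f : T -> R) :
  (forall x, D x -> (0 < f x)%R) -> measurable_fun D f ->
  measurable_fun D (fun x => (f x)^-1%R).
Proof.
move=> f0 mf.
apply: (eq_measurable_fun (fun x => expR (- ln (f x)))).
  by move=> x /set_mem Dx; rewrite expRN lnK// posrE f0.
apply: measurableT_comp; first exact: measurable_expR.
by apply: measurable_funN; apply: measurableT_comp; first exact: measurable_ln.
Qed.

Lemma integral_gt0_eq0 (D : set T) (f : T -> R) :
  measurable D -> measurable_fun D f -> (forall x, D x -> (0 < f x)%R) ->
  \int[mu]_(x in D) (f x)%:E = 0 -> mu D = 0.
Proof.
move=> mD mf f0 fI0.
have mf' : measurable_fun D (EFin \o f) by exact/measurable_EFinP.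
have : \int[mu]_(x in D) `|(EFin \o f) x| = 0.
  by rewrite -fI0; apply: eq_integral => x /set_mem /f0 fx0; rewrite gee0_abs// lee_fin ltW.
move=> /(ae_eq_integral_abs mu mD mf')[A [mA A0 DA]].
apply: (subset_measure0 mD mA _ A0) => x Dx; apply: DA => /= /(_ Dx)[fx0].
by have := f0 x Dx; rewrite fx0 ltxx.
Qed.

(** Since the integral of f is finite it cancels, leaving a positive function g - f with integral
    0. *)
Lemma integral_eq_lt_eq0 (D : set T) (f g : T -> R) :
  measurable D -> measurable_fun D f -> measurable_fun D g ->
  (forall x, D x -> (0 <= f x)%R) -> (forall x, D x -> (f x < g x)%R) ->
  \int[mu]_(x in D) (f x)%:E < +oo ->
  \int[mu]_(x in D) (f x)%:E = \int[mu]_(x in D) (g x)%:E -> mu D = 0.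
Proof.
move=> mD mf mg f0 fg ffin fgI.
have mgf : measurable_fun D (fun x => (g x - f x)%R) by exact: measurable_funB.
apply: (integral_gt0_eq0 mD mgf); first by move=> x /fg; rewrite subr_gt0.
have : \int[mu]_(x in D) (f x)%:E =
    \int[mu]_(x in D) (f x)%:E + \int[mu]_(x in D) (g x - f x)%:E.
  rewrite -ge0_integralD; last 5 first.
  - exact: mD.
  - by move=> x Dx; rewrite lee_fin f0.
  - exact/measurable_EFinP.
  - by move=> x Dx; rewrite lee_fin subr_ge0 ltW// fg.
  - exact/measurable_EFinP.
  by rewrite fgI; apply: eq_integral => x _; rewrite -EFinD addrC subrK.
have : 0 <= \int[mu]_(x in D) (f x)%:E by apply: integral_ge0 => x Dx; rewrite lee_fin f0.
move: ffin; case: (\int[mu]_(x in D) (f x)%:E) => [a||]// _ _.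
case: (\int[mu]_(x in D) (g x - f x)%:E) => [b||]//= [/eqP].
by rewrite -subr_eq0 opprD addNKr oppr_eq0 => /eqP ->.
Qed.

Variables (U : set T) (w t : T -> R).
Hypotheses (mU : measurable U) (mw : measurable_fun U w) (mt : measurable_fun U t).
Hypotheses (w0 : forall x, U x -> (0 < w x)%R) (t0 : forall x, U x -> (0 < t x)%R).
Hypotheses (wfin : \int[mu]_(x in U) (w x)%:E < +oo)
           (tfin : \int[mu]_(x in U) (t x)%:E < +oo).

Let W := \int[mu]_(x in U) (w x)%:E.
Let N := \int[mu]_(x in U) (t x)%:E.
Let E := \int[mu]_(x in U) (t x ^+ 2 / w x)%:E.

(* Relies on the conventions 0^-1 = +oo and 0 * +oo = 0. *)
Lemma quadratic_energy_degenerate : W = 0 ->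
  E = N ^+ 2 / W /\
  forall B, measurable B -> B `<=` U ->
    \int[mu]_(x in B) (t x)%:E / N = \int[mu]_(x in B) (w x)%:E / W.
Proof.
move=> W0; have U0 : mu U = 0 by exact: integral_gt0_eq0 W0.
have mwV := measurable_funV_pos w0 mw.
have I0 (f : T -> R) B : measurable_fun U f -> measurable B -> B `<=` U ->
    \int[mu]_(x in B) (f x)%:E = 0.
  move=> mf mB BU; apply: null_set_integral => //.
    by apply/measurable_EFinP; exact: measurable_funS mf.
  by apply: (subset_measure0 mB mU BU).
have N0 : N = 0 by exact: I0.
split=> [|B mB BU]; last by rewrite !I0// !mul0e.
by rewrite N0 W0 expe2 !mul0e /E I0//; apply: measurable_funM => //; exact: measurable_funX.
Qed.

Section nondegenerate.
Hypothesis W0 : W != 0.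
Let c : R := (fine N / fine W)%R.
Let e x : R := ((t x - c * w x) ^+ 2 / w x)%R.

Let W_ge0 : 0 <= W.
Proof. by apply: integral_ge0 => x Ux; rewrite lee_fin ltW// w0. Qed.

Let N_ge0 : 0 <= N.
Proof. by apply: integral_ge0 => x Ux; rewrite lee_fin ltW// t0. Qed.

Let WE : W = (fine W)%:E.
Proof. by rewrite fineK// ge0_fin_numE. Qed.

Let NE : N = (fine N)%:E.
Proof. by rewrite fineK// ge0_fin_numE. Qed.

Let Wgt0 : (0 < fine W)%R.
Proof. by rewrite -lte_fin -WE lt_def W0 W_ge0. Qed.

Let Ngt0 : (0 < fine N)%R.
Proof.
rewrite -lte_fin -NE lt_def N_ge0 andbT; apply/eqP => N0.
have U0 : mu U = 0 by exact: integral_gt0_eq0 N0.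
move/eqP: W0; apply; apply: null_set_integral => //.
exact/measurable_EFinP.
Qed.

Let c_gt0 : (0 < c)%R. Proof. by rewrite divr_gt0. Qed.

Let me_ : measurable_fun U e.
Proof.
apply: measurable_funM; last exact: measurable_funV_pos.
apply: measurable_funX; apply: measurable_funB => //.
exact: measurable_funM.
Qed.

Let e0 x : U x -> (0 <= e x)%R.
Proof. by move=> Ux; rewrite /e divr_ge0 ?sqr_ge0// ltW// w0. Qed.

Let ratioE : N ^+ 2 / W = (fine N ^+ 2 / fine W)%:E.
Proof.
by rewrite expe2 NE WE inver gt_eqF// -!EFinM -expr2.
Qed.

Let energyE : E = \int[mu]_(x in U) (e x)%:E + N ^+ 2 / W.
Proof.
have mwV := measurable_funV_pos w0 mw.
(* The expanded square with its negative terms moved across, so that only nonnegative integrands are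
   added: E is not known to be finite. *)
have S : E + (c ^+ 2)%:E * W = \int[mu]_(x in U) (e x)%:E + (2 * c)%:E * N.
  have mt2w : measurable_fun U (fun x => t x ^+ 2 / w x)%R.
    by apply: measurable_funM => //; exact: measurable_funX.
  have c2 : (0 <= 2 * c)%R by rewrite mulr_ge0// ltW.
  have c20 : (0 <= c ^+ 2)%R by exact: sqr_ge0.
  have w0' x : U x -> 0 <= (w x)%:E by move=> Ux; rewrite lee_fin ltW// w0.
  have t0' x : U x -> 0 <= (t x)%:E by move=> Ux; rewrite lee_fin ltW// t0.
  have e0' x : U x -> 0 <= (e x)%:E by move=> Ux; rewrite lee_fin e0.
  have q0' x : U x -> 0 <= (t x ^+ 2 / w x)%:E.
    by move=> Ux; rewrite lee_fin divr_ge0 ?sqr_ge0// ltW// w0.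
  have cw0' x : U x -> 0 <= (c ^+ 2)%:E * (w x)%:E by move=> Ux; rewrite mule_ge0 ?w0'.
  have ct0' x : U x -> 0 <= (2 * c)%:E * (t x)%:E by move=> Ux; rewrite mule_ge0 ?t0'.
  have mw' : measurable_fun U (fun x => (w x)%:E) by exact/measurable_EFinP.
  have mt' : measurable_fun U (fun x => (t x)%:E) by exact/measurable_EFinP.
  have me' : measurable_fun U (fun x => (e x)%:E) by exact/measurable_EFinP.
  have mq' : measurable_fun U (fun x => (t x ^+ 2 / w x)%:E) by exact/measurable_EFinP.
  have mcw : measurable_fun U (fun x => (c ^+ 2)%:E * (w x)%:E) by exact: measurable_funeM.
  have mct : measurable_fun U (fun x => (2 * c)%:E * (t x)%:E) by exact: measurable_funeM.
  rewrite /W /N /E -!ge0_integralZl_EFin// -!ge0_integralD//.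
  apply: eq_integral => x /set_mem Ux; rewrite -!EFinM -!EFinD /e; congr EFin.
  by field; rewrite gt_eqF// w0.
rewrite ratioE; move: S; rewrite NE WE.
have -> : ((c ^+ 2)%:E * (fine W)%:E = (fine N ^+ 2 / fine W)%:E).
  by rewrite -EFinM /c; congr EFin; field; rewrite gt_eqF.
have -> : ((2 * c)%:E * (fine N)%:E = (fine N ^+ 2 / fine W *+ 2)%:E).
  by rewrite -EFinM /c; congr EFin; field; rewrite gt_eqF.
case: E => [a||]; case: (\int[mu]_(x in U) (e x)%:E) => [b||]//= [].
by move=> h; congr EFin; lra.
Qed.

Lemma energy_ge : N ^+ 2 / W <= E.
Proof.
by rewrite energyE leeDr// integral_ge0// => x Ux; rewrite lee_fin e0.
Qed.

Let ratio_iff B : (\int[mu]_(x in B) (t x)%:E / N = \int[mu]_(x in B) (w x)%:E / W) <->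
  \int[mu]_(x in B) (t x)%:E = c%:E * \int[mu]_(x in B) (w x)%:E.
Proof.
rewrite NE WE !inver !gt_eqF//; split=> [h|->].
  rewrite -[LHS]mule1 -[1](_ : (fine N)^-1%:E * (fine N)%:E = _); last first.
    by rewrite -EFinM mulVf// gt_eqF.
  by rewrite muleA h -muleA -EFinM muleC /c (mulrC (fine W)^-1%R).
rewrite muleAC -EFinM muleC; congr (_ * _%:E).
by rewrite /c; field; rewrite !gt_eqF.
Qed.

Lemma energy_eq_ratio : E = N ^+ 2 / W ->
  forall B, measurable B -> B `<=` U ->
    \int[mu]_(x in B) (t x)%:E / N = \int[mu]_(x in B) (w x)%:E / W.
Proof.
move=> EE B mB BU; apply/ratio_iff.
have : \int[mu]_(x in U) `|(EFin \o e) x| = 0.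
  transitivity (\int[mu]_(x in U) (e x)%:E).
    by apply: eq_integral => x /set_mem Ux; rewrite gee0_abs// lee_fin e0.
  move: energyE; rewrite EE ratioE.
  case: (\int[mu]_(x in U) (e x)%:E) => [b||]//= [h].
  by congr EFin; lra.
have me' : measurable_fun U (EFin \o e) by exact/measurable_EFinP.
move=> /(ae_eq_integral_abs mu mU me')[A [mA A0 UA]].
have mwB : measurable_fun B w by exact: measurable_funS mw.
have mtB : measurable_fun B t by exact: measurable_funS mt.
rewrite -ge0_integralZl_EFin//; last 3 first.
- by move=> x /BU Ux; rewrite lee_fin ltW// w0.
- exact/measurable_EFinP.
- exact: ltW.
apply: ge0_ae_eq_integral => //.
- exact/measurable_EFinP.
- by apply: measurable_funeM; exact/measurable_EFinP.
- by move=> x /BU Ux; rewrite lee_fin ltW// t0.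
- by move=> x /BU Ux; rewrite mule_ge0 ?lee_fin ?ltW// w0.
exists A; split=> // x /= h; apply: UA => /= h'; apply: h => Bx.
have Ux := BU _ Bx; have [/eqP] := h' Ux; rewrite /e mulf_eq0 sqrf_eq0 invr_eq0.
by rewrite (gt_eqF (w0 Ux)) orbF subr_eq0 => /eqP ->.
Qed.

(** On the set where t exceeds c w, and on the set where it is below, the two integrals agree
    although the integrands are strictly ordered; both sets are therefore null. *)
Lemma ratio_energy_eq :
  (forall B, measurable B -> B `<=` U ->
    \int[mu]_(x in B) (t x)%:E / N = \int[mu]_(x in B) (w x)%:E / W) ->
  E = N ^+ 2 / W.
Proof.
move=> h; have {}h B : measurable B -> B `<=` U ->
    \int[mu]_(x in B) (t x)%:E = \int[mu]_(x in B) (c * w x)%:E.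
  move=> mB BU; have mwB : measurable_fun B w by exact: measurable_funS mw.
  have mwB' : measurable_fun B (fun x => (w x)%:E) by exact/measurable_EFinP.
  have w0' x : B x -> 0 <= (w x)%:E by move=> /BU Ux; rewrite lee_fin ltW// w0.
  have c0 : (0 <= c)%R by exact: ltW.
  rewrite (ratio_iff B).1; last exact: h.
  by rewrite -ge0_integralZl_EFin//.
have mcw : measurable_fun U (fun x => c * w x)%R by exact: measurable_funM.
have md : measurable_fun U (fun x => t x - c * w x)%R by exact: measurable_funB.
have tfinB B : measurable B -> B `<=` U -> \int[mu]_(x in B) (t x)%:E < +oo.
  move=> mB BU; apply: le_lt_trans tfin; apply: ge0_subset_integral => //.
    exact/measurable_EFinP.
  by move=> x Ux; rewrite lee_fin ltW// t0.
pose B1 := U `&` (fun x => t x - c * w x)%R @^-1` `]0%R, +oo[%classic.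
pose B2 := U `&` (fun x => t x - c * w x)%R @^-1` `]-oo, 0%R[%classic.
have mB1 : measurable B1 by apply: md => //; exact: measurable_itv.
have mB2 : measurable B2 by apply: md => //; exact: measurable_itv.
have B1U : B1 `<=` U by move=> x [].
have B2U : B2 `<=` U by move=> x [].
have B10 : mu B1 = 0.
  apply: (@integral_eq_lt_eq0 _ (fun x => c * w x)%R t) => //.
  - exact: measurable_funS mcw.
  - exact: measurable_funS mt.
  - by move=> x [Ux _]; rewrite mulr_ge0 ?ltW// w0.
  - by move=> x [Ux] /=; rewrite in_itv/= andbT subr_gt0.
  - by rewrite -h// tfinB.
  - by rewrite h.
have B20 : mu B2 = 0.
  apply: (@integral_eq_lt_eq0 _ t (fun x => c * w x)%R) => //.
  - exact: measurable_funS mt.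
  - exact: measurable_funS mcw.
  - by move=> x [Ux _]; rewrite ltW// t0.
  - by move=> x [Ux] /=; rewrite in_itv/= subr_lt0.
  - by rewrite tfinB.
  - by rewrite h.
rewrite energyE (@ge0_negligible_integral _ _ _ _ _ (B1 `|` B2))//.
- rewrite integral0_eq ?add0e// => x [Ux nB]; congr EFin.
  suff tw : (t x = c * w x)%R by rewrite /e tw subrr expr0n mul0r.
  apply/eqP; apply: contra_notT nB; rewrite neq_lt => /orP[tw|tw]; [right|left].
    by split=> //=; rewrite in_itv/= subr_lt0.
  by split=> //=; rewrite in_itv/= andbT subr_gt0.
- exact: measurableU.
- exact/measurable_EFinP.
- by rewrite measureU0.
Qed.

End nondegenerate.

Lemma quadratic_energy_ge : N ^+ 2 / W <= E.
Proof.
have [/quadratic_energy_degenerate[<-]//|] := eqVneq W 0; exact: energy_ge.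
Qed.

Lemma quadratic_energy_eq : E = N ^+ 2 / W <->
  forall B, measurable B -> B `<=` U ->
    \int[mu]_(x in B) (t x)%:E / N = \int[mu]_(x in B) (w x)%:E / W.
Proof.
have [/quadratic_energy_degenerate[-> h]//|W0] := eqVneq W 0.
by split; [exact: energy_eq_ratio|exact: ratio_energy_eq].
Qed.

End quadratic_energy.

(** * Admissible maps in coordinates *)

Section homeomorphisms.

Lemma homeomorphic_compactr (S T : topologicalType) (A : set S) (B : set T) :
  homeomorphic A B -> compact A -> compact B.
Proof.
move=> [g [[gAB _ gsurj] cg _]] cA.
have -> : B = g @` A.
  by apply/seteqP; split=> [y /gsurj[x Ax <-]|_ [x Ax <-]]; [exists x|exact: gAB].
exact: continuous_compact.
Qed.

Lemma homeomorphism_compactl (S T : topologicalType) (A : set S) (B : set T) g :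
  homeomorphism A B g -> compact B -> compact A.
Proof.
move=> [[gAB _ gsurj] _ [g' cg' g'K]] cB.
have -> : A = g' @` B.
  apply/seteqP; split=> [x Ax|_ [y /gsurj[x Ax <-] <-]]; last by rewrite g'K.
  by exists (g x); [exact: gAB|exact: g'K].
exact: continuous_compact.
Qed.

Lemma unit_ball_compact (R : realType) n : compact (@unit_ball R n).
Proof.
apply: bounded_closed_compact.
  exists 1; split=> // r r1 x /= x1; apply: le_trans (ltW r1).
  rewrite ler_rV_norm//; apply/forallP => i.
  rewrite -(@ler_pXn2r _ 2)// ?nnegrE// expr1n -normrX ger0_norm ?sqr_ge0//.
  by apply: le_trans x1; rewrite (bigD1 i)//= lerDl sumr_ge0// => j _; exact: sqr_ge0.
have -> : @unit_ball R n = (fun x : 'rV[R]_n => (x *m x^T) 0 0) @^-1` [set y | y <= 1].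
  by apply/seteqP; split=> x; rewrite /unit_ball /= mulmx_trE.
apply: closed_comp; last exact: closed_le.
move=> x _; have cx : id y @[y --> x] --> x by exact: cvg_id.
exact: (cvg_mx_coord (i := 0) (j := 0) (cvg_mulmx cx (cvg_trmx cx))).
Qed.

End homeomorphisms.

Section manifolds.
Context {R : realType} {n m : nat} (M : manifold R n m).

Lemma mpar_inj u v : mdom M u -> mdom M v -> mpar M u = mpar M v -> u = v.
Proof.
move=> Mu Mv uv; have [[_ inj _] _ _] := mpar_homeo M.
by apply: inj => //; rewrite inE.
Qed.

Lemma mcoordK u : mdom M u -> mcoord M (mpar M u) = u.
Proof. by move=> Mu; exact: (inv_onK mpar_inj). Qed.

Lemma mcoordP x : (M : set _) x -> mdom M (mcoord M x) /\ mpar M (mcoord M x) = x.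
Proof. by move=> [u Mu <-]; rewrite mcoordK. Qed.

(** The homeomorphism only provides some continuous left inverse; it agrees with [mcoord] on M. *)
Lemma mcoord_continuous : {within (M : set _), continuous (mcoord M)}.
Proof.
have [_ _ [g' cg' g'K]] := mpar_homeo M.
apply: (subspace_eq_continuous _ cg') => x; rewrite inE => -[u Mu <-].
by rewrite /from_subspace g'K// mcoordK.
Qed.

Lemma mpar_C1 : exists O, [/\ open O, mdom M `<=` O & is_Ck 1 O (mpar M)].
Proof. by have [V [oV MV CV]] := mpar_smooth M; exists V; split=> //; exact: (CV 1%N). Qed.

Lemma mpar_strict_diff u : mdom M u ->
  strict_diff (mdom M) (mpar M) u (jacobian (mpar M) u).
Proof.
move=> Mu; have [V [oO MO CO]] := mpar_C1.
exact: (strict_diffS MO (C1_strict_diff oO CO (MO _ Mu))).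
Qed.

Lemma mpar_differentiable u : mdom M u -> differentiable (mpar M) u.
Proof. by move=> Mu; have [V [oO MO [dO _]]] := mpar_C1; exact: (dO _ (MO _ Mu)). Qed.

Lemma mpar_jacobian_cvg u : mdom M u ->
  jacobian (mpar M) z @[z --> u] --> jacobian (mpar M) u.
Proof.
move=> Mu; have [V [oO MO CO]] := mpar_C1.
exact: (C1_jacobian_cvg oO CO (MO _ Mu)).
Qed.

Lemma mpar_continuous : {within mdom M, continuous (mpar M)}.
Proof. by have [_ + _] := mpar_homeo M. Qed.

Definition gram u : R := \det ((jac (mpar M) u)^T *m jac (mpar M) u).

Lemma gram_gt0 u : mdom M u -> 0 < gram u.
Proof. by move=> Mu; apply: gram_det_gt0; exact: mpar_full_rank. Qed.

Lemma gram_cvg u : mdom M u -> gram z @[z --> u] --> gram u.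
Proof.
move=> Mu; have cJ : jac (mpar M) z @[z --> u] --> jac (mpar M) u.
  exact: (cvg_trmx (mpar_jacobian_cvg Mu)).
exact: (cvg_det (cvg_mulmx (cvg_trmx cJ) cJ)).
Qed.

Lemma measurable_sqrt_gram : compact (mdom M) ->
  measurable_fun (mdom M) (fun u => Num.sqrt (gram u) : measurableTypeR R).
Proof.
move=> cM; apply: within_continuous_measurable.
  exact: (compact_closed (@norm_hausdorff _ _) cM).
apply/subspace_continuousP => u Mu.
have cs : Num.sqrt (gram z) @[z --> u] --> Num.sqrt (gram u).
  exact: (cvg_comp _ _ (gram_cvg Mu) (@sqrt_continuous R (gram u))).
exact: (cvg_trans (cvg_app _ (cvg_within _)) cs).
Qed.

End manifolds.

Lemma within_continuous_comp (S T V : topologicalType) (A : set S) (B : set T)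
    (f : S -> T) (g : T -> V) :
  (forall x, A x -> B (f x)) -> {within A, continuous f} -> {within B, continuous g} ->
  {within A, continuous (g \o f)}.
Proof.
move=> AB /subspace_continuousP cf /subspace_continuousP cg.
apply/subspace_continuousP => x Ax P nP.
have h1 : within B (nbhs (f x)) (g @^-1` P) := cg _ (AB _ Ax) P nP.
have h2 : within A (nbhs x) (f @^-1` [set y | B y -> P (g y)]) := cf _ Ax _ h1.
rewrite /within/= in h2 *; apply: filterS h2 => y h Ay; exact: (h Ay (AB _ Ay)).
Qed.

Lemma measurable_density (R : realType) n m (M : manifold R n m) (rho : 'rV[R]_m -> R) :
  compact (mdom M) -> measurable_fun (M : set 'rV[R]_m) rho ->
  measurable_fun (mdom M) (fun u => rho (mpar M u) * Num.sqrt (gram M u)).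
Proof.
move=> cM mrho; apply: measurable_funM; last exact: measurable_sqrt_gram.
have cMM : compact (M : set 'rV[R]_m) := continuous_compact (@mpar_continuous _ _ _ M) cM.
apply: (measurable_comp (compact_measurable_rV cMM) _ mrho).
  by move=> _ [u Mu <-]; exists u.
apply: within_continuous_measurable_rV; last exact: mpar_continuous.
exact: (compact_closed (@norm_hausdorff _ _) cM).
Qed.

Section admissible_maps.
Context {R : realType} {n m p : nat} (M : manifold R n m) (N : manifold R n p).
Variable f : 'rV[R]_m -> 'rV[R]_p.
Hypotheses (cM : compact (mdom M)) (adm : admissible M N f).

Definition chart_map (u : 'rV[R]_n) : 'rV[R]_n := mcoord N (f (mpar M u)).

Lemma chart_mapP u : mdom M u ->
  mdom N (chart_map u) /\ mpar N (chart_map u) = f (mpar M u).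
Proof.
move=> Mu; have [_ [fMN _ _] _ _] := adm.
by apply: mcoordP; apply: fMN; exists u.
Qed.

Lemma chart_map_inj u v : mdom M u -> mdom M v ->
  f (mpar M u) = f (mpar M v) -> u = v.
Proof.
move=> Mu Mv uv; have [_ [_ finj _] _ _] := adm.
apply: (mpar_inj Mu Mv); apply: finj => //; rewrite inE; [by exists u|by exists v].
Qed.

Lemma chart_map_image : chart_map @` mdom M = mdom N.
Proof.
apply/seteqP; split=> [_ [u Mu <-]|v Nv]; first by have [] := chart_mapP Mu.
have [_ [_ _ fsurj] _ _] := adm.
have [|x [u Mu <-] fx] := fsurj (mpar N v); first by exists v.
by exists u => //; rewrite /chart_map fx mcoordK.
Qed.

Lemma image_admissible : f @` (M : set _) = N.
Proof.
have [_ [fMN _ fsurj] _ _] := adm.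
by apply/seteqP; split=> [_ [x Mx <-]|y /fsurj//]; exact: fMN.
Qed.

Let f_differentiable x : (M : set _) x -> differentiable f x.
Proof. by move=> Mx; have [[V [oV MV [dV _]]] _ _ _] := adm; exact: (dV _ (MV _ Mx)). Qed.

Let jac_compE u : mdom M u ->
  jacobian (f \o mpar M) u = jacobian (mpar M) u *m jacobian f (mpar M u).
Proof.
move=> Mu; apply: jacobian_comp; first exact: mpar_differentiable.
by apply: f_differentiable; exists u.
Qed.

Let comp_strict_diff u : mdom M u ->
  strict_diff (mdom M) (f \o mpar M) u (jacobian (f \o mpar M) u).
Proof.
move=> Mu; rewrite jac_compE//; have [[V [oV MV CV]] _ _ _] := adm.
have Mhu : (M : set _) (mpar M u) by exists u.
apply: (@strict_diff_comp _ _ _ _ (mdom M) V) => //.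
- by move=> x Mx; apply: MV; exists x.
- exact: mpar_strict_diff.
- by apply: C1_strict_diff => //; exact: MV.
Qed.

Lemma comp_par_continuous : {within mdom M, continuous (f \o mpar M)}.
Proof. exact: (strict_diff_continuous comp_strict_diff). Qed.

Let chart_map_continuous : {within mdom M, continuous chart_map}.
Proof.
apply: (@within_continuous_comp _ _ _ _ (N : set _) (f \o mpar M) (mcoord N)).
- by move=> u Mu; have [_ [fMN _ _] _ _] := adm; apply: fMN; exists u.
- exact: comp_par_continuous.
- exact: mcoord_continuous.
Qed.

(** The limit is taken within [mdom M] because the chain rule [jac_compE] is available at its
    points. *)
Let jac_comp_cvg u : mdom M u ->
  jac (f \o mpar M) z @[z --> within (mdom M) (nbhs u)] --> jac (f \o mpar M) u.
Proof.
move=> Mu; have [[V [oV MV CV]] _ _ _] := adm.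
have Mhu : (M : set _) (mpar M u) by exists u.
have c1 : jacobian (mpar M) z @[z --> within (mdom M) (nbhs u)] --> jacobian (mpar M) u.
  exact: (cvg_trans (cvg_app _ (cvg_within _)) (mpar_jacobian_cvg Mu)).
have c2 : jacobian f (mpar M z) @[z --> within (mdom M) (nbhs u)] -->
    jacobian f (mpar M u).
  have ch : mpar M z @[z --> within (mdom M) (nbhs u)] --> mpar M u.
    by have /subspace_continuousP := @mpar_continuous _ _ _ M; apply.
  exact: (cvg_comp _ _ ch (C1_jacobian_cvg oV CV (MV _ Mhu))).
have c3 : (jacobian (mpar M) z *m jacobian f (mpar M z))^T
    @[z --> within (mdom M) (nbhs u)] -->
    (jacobian (mpar M) u *m jacobian f (mpar M u))^T.
  exact: (cvg_trmx (cvg_mulmx c1 c2)).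
have E : \forall z \near within (mdom M) (nbhs u),
    (jacobian (mpar M) z *m jacobian f (mpar M z))^T = jac (f \o mpar M) z.
  by apply: filterS (withinT _ _) => z Mz; rewrite /jac jac_compE.
have -> : jac (f \o mpar M) u = (jacobian (mpar M) u *m jacobian f (mpar M u))^T.
  by rewrite /jac jac_compE.
exact: (cvg_trans (near_eq_cvg E) c3).
Qed.

(** Preservation of orientation supplies the matrices one point at a time, without regularity:
    strict differentiability comes from lifting f o h through the parametrization of N. The
    transpose is there because D acts on row vectors. *)
Lemma admissible_embedding : exists D : 'rV[R]_n -> 'M[R]_n,
  strict_embedding (mdom M) chart_map D /\
  forall u, mdom M u -> 0 < \det (D u) /\
    jac (f \o mpar M) u = jac (mpar N) (chart_map u) *m (D u)^T.
Proof.
have [_ _ orient _] := adm.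
have /choice[D DP] : forall u, exists D : 'M[R]_n, mdom M u -> 0 < \det D /\
    jac (f \o mpar M) u = jac (mpar N) (chart_map u) *m D^T.
  move=> u; have [Mu|nMu] := pselect (mdom M u); last by exists 0.
  have [Nu Nfu] := chart_mapP Mu.
  by have [G G0 GE] := orient u _ Mu Nu Nfu; exists G^T => _; rewrite det_tr trmxK.
exists D; split=> //; split=> //.
- move=> u v Mu Mv uv; apply: chart_map_inj => //.
  by have [_ <-] := chart_mapP Mu; have [_ <-] := chart_mapP Mv; rewrite uv.
- move=> u Mu; have [Nu Nfu] := chart_mapP Mu; have [_ JE] := DP u Mu.
  pose B := jacobian (mpar N) (chart_map u).
  have uB : B *m B^T \in unitmx.
    by rewrite unitmxE unitfE; have := mpar_full_rank Nu; rewrite /jac trmxK.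
  (* Full rank of N makes [B *m B^T] invertible, which yields this right inverse of B. *)
  apply: (@strict_diff_lift _ _ _ _ (mdom M) (mdom N) (f \o mpar M) (mpar N) _ u
    (jacobian (f \o mpar M) u) B (B^T *m invmx (B *m B^T))) => //.
  + by move=> x Mx; have [] := chart_mapP Mx.
  + by move=> x Mx; have [_ ->] := chart_mapP Mx.
  + exact: comp_strict_diff.
  + exact: mpar_strict_diff.
  + by rewrite mulmxA mulmxV.
  + by apply: trmx_inj; rewrite trmx_mul; exact: JE.
- by move=> u Mu; have [D0 _] := DP u Mu; rewrite unitmxE unitfE gt_eqF.
- pose jf u := jac (f \o mpar M) u.
  (* Gram determinants express [|\det (D u)|] through continuous quantities, although D was chosen
     point by point. *)
  have DE u : mdom M u ->
      `|\det (D u)| = Num.sqrt (\det ((jf u)^T *m jf u) / gram N (chart_map u)).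
    move=> Mu; have [D0 JE] := DP u Mu; have [Nu _] := chart_mapP Mu.
    have -> : \det ((jf u)^T *m jf u) = \det (D u) ^+ 2 * gram N (chart_map u).
      rewrite /jf JE trmx_mul trmxK -mulmxA [X in \det (_ *m X)]mulmxA.
      by rewrite det_mulmx [X in _ * X]det_mulmx det_tr /gram; ring.
    by rewrite mulfK ?gt_eqF ?gram_gt0// sqrtr_sqr.
  apply/subspace_continuousP => u Mu; have [Nu _] := chart_mapP Mu.
  have c1 : \det ((jf z)^T *m jf z) @[z --> within (mdom M) (nbhs u)] -->
      \det ((jf u)^T *m jf u).
    have cj := jac_comp_cvg Mu.
    exact: (cvg_det (cvg_mulmx (cvg_trmx cj) cj)).
  have c2 : gram N (chart_map z) @[z --> within (mdom M) (nbhs u)] --> gram N (chart_map u).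
    have cc : chart_map z @[z --> within (mdom M) (nbhs u)] --> chart_map u.
      by have /subspace_continuousP := chart_map_continuous; apply.
    exact: (cvg_comp _ _ cc (gram_cvg Nu)).
  have g0 : gram N (chart_map u) != 0 by rewrite gt_eqF// gram_gt0.
  have c3 : Num.sqrt (\det ((jf z)^T *m jf z) / gram N (chart_map z))
      @[z --> within (mdom M) (nbhs u)] -->
      Num.sqrt (\det ((jf u)^T *m jf u) / gram N (chart_map u)).
    exact: (cvg_comp _ _ (cvgM c1 (cvgV g0 c2)) (@sqrt_continuous R _)).
  have E : \forall z \near within (mdom M) (nbhs u),
      Num.sqrt (\det ((jf z)^T *m jf z) / gram N (chart_map z)) = `|\det (D z)|.
    by apply: filterS (withinT _ _) => z Mz; rewrite DE.
  have subst_lim (l : R) : `|\det (D u)| = l ->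
      `|\det (D z)| @[z --> within (mdom M) (nbhs u)] --> l ->
      `|\det (D z)| @[z --> within (mdom M) (nbhs u)] --> `|\det (D u)|.
    by move=> <-.
  exact: (subst_lim _ (DE u Mu) (cvg_trans (near_eq_cvg E) c3)).
Qed.

End admissible_maps.

(** * Energy and mass preservation in coordinates *)

Section energy.
Context {R : realType} {n m p : nat} (M : manifold R n m) (N : manifold R n p).
Variables (rho_mu : 'rV[R]_m -> R) (rho_nu : 'rV[R]_p -> R).
Hypotheses (cM : compact (mdom M)) (cN : compact (mdom N)).
Hypotheses (mrho_mu : measurable_fun (M : set 'rV[R]_m) rho_mu)
           (mrho_nu : measurable_fun (N : set 'rV[R]_p) rho_nu).
Hypotheses (rho_mu0 : forall x, (M : set 'rV[R]_m) x -> 0 < rho_mu x)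
           (rho_nu0 : forall y, (N : set 'rV[R]_p) y -> 0 < rho_nu y).
Hypotheses (mu_fin : (density_measure M rho_mu M < +oo)%E)
           (nu_fin : (density_measure N rho_nu N < +oo)%E).
Variable f : 'rV[R]_m -> 'rV[R]_p.
Hypothesis adm : admissible M N f.

Notation lam := (lebesgue_rV n).
Notation mu := (density_measure M rho_mu).
Notation nu := (density_measure N rho_nu).

Lemma density_measureE k q (Q : manifold R k q) rho B :
  density_measure Q rho B =
  (\int[lebesgue_rV k]_(u in mdom Q `&` mpar Q @^-1` B)
    (rho (mpar Q u) * Num.sqrt (gram Q u))%:E)%E.
Proof. by []. Qed.

Lemma mdom_par_preimage k q (Q : manifold R k q) : mdom Q `&` mpar Q @^-1` Q = mdom Q.
Proof. by apply/seteqP; split=> [u []//|u Qu]; split=> //; exists u. Qed.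

Lemma stretch_energy_ratio :
  let c := (nu N ^+ 2 / mu M)%E in
  (c <= stretch_energy M rho_mu rho_nu f)%E /\
  (stretch_energy M rho_mu rho_nu f = c <-> mass_preserving M N rho_mu rho_nu f).
Proof.
have [D [emb DP]] := admissible_embedding cM adm.
pose phi := chart_map M N f.
have phiP u : mdom M u -> mdom N (phi u) /\ mpar N (phi u) = f (mpar M u).
  exact: (chart_mapP adm).
have mM : measurable (mdom M) by exact: compact_measurable_rV.
have mN : measurable (mdom N) by exact: compact_measurable_rV.
pose w u := rho_mu (mpar M u) * Num.sqrt (gram M u).
pose s v := rho_nu (mpar N v) * Num.sqrt (gram N v).
pose t u := s (phi u) * `|\det (D u)|.
have mw : measurable_fun (mdom M) w by exact: measurable_density.
have ms : measurable_fun (mdom N) s by exact: measurable_density.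
have mphi : measurable_fun (mdom M) phi.
  have [_ _ sd _ _] := emb; apply: within_continuous_measurable_rV.
    exact: (compact_closed (@norm_hausdorff _ _) cM).
  exact: (strict_diff_continuous sd).
have mt : measurable_fun (mdom M) t.
  apply: measurable_funM.
    by apply: (measurable_comp mN _ ms) => // _ [u Mu <-]; have [] := phiP u Mu.
  have [_ _ _ _ cD] := emb; apply: within_continuous_measurable => //.
  exact: (compact_closed (@norm_hausdorff _ _) cM).
have w0 u : mdom M u -> 0 < w u.
  by move=> Mu; rewrite mulr_gt0 ?sqrtr_gt0 ?gram_gt0// rho_mu0//; exists u.
have s0 v : mdom N v -> 0 < s v.
  by move=> Nv; rewrite mulr_gt0 ?sqrtr_gt0 ?gram_gt0// rho_nu0//; exists v.
have t0 u : mdom M u -> 0 < t u.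
  move=> Mu; have [Nu _] := phiP u Mu; have [D0 _] := DP u Mu.
  by rewrite mulr_gt0 ?s0// normr_gt0 gt_eqF.
have muE B : mu B = (\int[lam]_(u in mdom M `&` mpar M @^-1` B) (w u)%:E)%E by [].
have mfM : measurable_fun (mdom M) (f \o mpar M).
  apply: within_continuous_measurable_rV; first exact: (compact_closed (@norm_hausdorff _ _) cM).
  exact: (comp_par_continuous adm).
(* The condition defining C is moved into the integrand, so that the change of variables is used on
   all of [mdom M]. *)
have nuE C : measurable C ->
    nu C = (\int[lam]_(u in mdom M `&` (f \o mpar M) @^-1` C) (t u)%:E)%E.
  move=> mC.
  rewrite density_measureE integral_mkcondr.
  rewrite -(chart_map_image adm) (ge0_change_of_variables emb).
  - rewrite integral_mkcondr; apply: eq_integral => u /set_mem Mu.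
    have [_ fE] := phiP u Mu.
    rewrite !patchE.
    have -> : (chart_map M N f u \in mpar N @^-1` C) = (u \in (f \o mpar M) @^-1` C).
      by apply/idP/idP => /set_mem h; apply/mem_set; move: h; rewrite /preimage/= fE.
    by case: ifP => _; rewrite ?mul0e// -EFinM.
  - rewrite (chart_map_image adm).
    pose P := mdom N `&` mpar N @^-1` C.
    have mP : measurable P.
      have mh : measurable_fun (mdom N) (mpar N).
        apply: within_continuous_measurable_rV; last exact: mpar_continuous.
        exact: (compact_closed (@norm_hausdorff _ _) cN).
      exact: (mh mN _ mC).
    apply: (eq_measurable_fun ((fun v => (s v)%:E) \_ P)).
      move=> v /set_mem Nv; rewrite !patchE.
      have -> // : (v \in P) = (v \in mpar N @^-1` C).
      by apply/idP/idP => /set_mem h; apply/mem_set; [case: h|split].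
    apply/measurable_restrict => //.
    apply: (measurable_funS mN); first by move=> v [].
    exact/measurable_EFinP.
  - rewrite (chart_map_image adm) => v Nv; rewrite patchE.
    by case: ifP => // _; rewrite lee_fin ltW// (s0 v Nv).
have muM : mu M = (\int[lam]_(u in mdom M) (w u)%:E)%E by rewrite muE mdom_par_preimage.
have nuN : nu N = (\int[lam]_(u in mdom M) (t u)%:E)%E.
  rewrite nuE; last first.
    apply: compact_measurable_rV; apply: continuous_compact cN.
    exact: mpar_continuous.
  congr integral; apply/seteqP; split=> [u []//|u Mu]; split=> //.
  by have [_ [fMN _ _] _ _] := adm; apply: fMN; exists u.
have EE : stretch_energy M rho_mu rho_nu f =
    (\int[lam]_(u in mdom M) (t u ^+ 2 / w u)%:E)%E.
  rewrite /stretch_energy /vol_integral mdom_par_preimage.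
  apply: eq_integral => u /set_mem Mu; have [Nu fE] := phiP u Mu.
  have [D0 JE] := DP u Mu.
  rewrite /tgrad mcoordK// JE Det_mul_mp_inverse ?det_tr//; last 2 first.
  - exact: mpar_full_rank.
  - exact: mpar_full_rank.
  rewrite -fE -/(gram M u) -/(gram N (phi u)) /t /s /w (gtr0_norm D0); congr EFin.
  have r0 : rho_mu (mpar M u) != 0 by rewrite gt_eqF// rho_mu0//; exists u.
  have g0 : Num.sqrt (gram M u) != 0 by rewrite gt_eqF// sqrtr_gt0 gram_gt0.
  by field; rewrite r0 g0.
have wfin : (\int[lam]_(u in mdom M) (w u)%:E < +oo)%E by rewrite -muM.
have tfin : (\int[lam]_(u in mdom M) (t u)%:E < +oo)%E by rewrite -nuN.
move=> c; split.
  by rewrite /c EE nuN muM; exact: quadratic_energy_ge.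
rewrite /c EE nuN muM (quadratic_energy_eq mM mw mt w0 t0 wfin tfin) -nuN -muM.
rewrite /mass_preserving (image_admissible adm).
(* [mass_preserving] tests subsets of N, [quadratic_energy_eq] subsets of the parameter domain; they
   correspond through f o h. *)
split=> [h A mA AN|h B mB BM].
  rewrite (nuE A mA) muE.
  rewrite (_ : mdom M `&` mpar M @^-1` (M `&` f @^-1` A) =
               mdom M `&` (f \o mpar M) @^-1` A); last first.
    apply/seteqP; split=> [u [Mu [_ fA]]|u [Mu fA]]; split=> //.
    by split=> //; exists u.
  by apply: h; [exact: mfM|move=> u []].
(* The image of B under f o h, written through the measurable inverse so that it is Borel. *)
pose A := (N : set _) `&` inv_on (mdom M) (f \o mpar M) @^-1` B.
have inj := chart_map_inj adm.
have mA : measurable A.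
  apply: measurableI.
    apply: compact_measurable_rV; apply: continuous_compact cN.
    exact: mpar_continuous.
  rewrite -[X in measurable X]setTI.
  apply: (measurable_inv_on inj cM (comp_par_continuous adm)) => //.
have AE : mdom M `&` (f \o mpar M) @^-1` A = B.
  apply/seteqP; split=> [u [Mu [_]]|u Bu]; first by rewrite /preimage/= (inv_onK inj).
  have Mu := BM _ Bu; split=> //; split; last by rewrite /preimage/= (inv_onK inj).
  by have [_ [fMN _ _] _ _] := adm; apply: fMN; exists u.
have := h A mA _; rewrite (nuE A mA) muE AE.
rewrite (_ : mdom M `&` mpar M @^-1` (M `&` f @^-1` A) = B); last first.
  rewrite -AE; apply/seteqP; split=> [u [Mu [_ fA]]|u [Mu fA]]; split=> //.
  by split=> //; exists u.
by apply => y [].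
Qed.

End energy.

Unset Implicit Arguments.

Theorem theorem1 (R : realType) (n m p : nat)
    (M : manifold R n m) (N : manifold R n p)
    (rho_mu : 'rV[R]_m -> R) (rho_nu : 'rV[R]_p -> R) (L : R)
    (M_ball : homeomorphic (M : set 'rV[R]_m) (@unit_ball R n))
    (M_N : homeomorphic (M : set 'rV[R]_m) (N : set 'rV[R]_p))
    (rho_mu_meas : measurable_fun (M : set 'rV[R]_m) rho_mu)
    (rho_nu_meas : measurable_fun (N : set 'rV[R]_p) rho_nu)
    (L_gt0 : 0 < L)
    (L_rho_mu : forall x, (M : set 'rV[R]_m) x -> L <= rho_mu x)
    (L_rho_nu : forall y, (N : set 'rV[R]_p) y -> L <= rho_nu y)
    (mu_fin : (density_measure M rho_mu M < +oo)%E)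
    (nu_fin : (density_measure N rho_nu N < +oo)%E) :
  let S := energy_set M N rho_mu rho_nu in
  let E := stretch_energy M rho_mu rho_nu in
  let c := ((density_measure N rho_nu N) ^+ 2 / density_measure M rho_mu M)%E in
  (c <= ereal_inf S)%E /\
  (forall f, admissible M N f ->
     (is_min S (E f) /\ E f = c) <-> mass_preserving M N rho_mu rho_nu f).
Proof.
(* Compactness passes from the unit ball to M, then to N, and from each manifold to its parameter
   domain. *)
have cMM : compact (M : set 'rV[R]_m).
  by have [g hg] := M_ball; exact: homeomorphism_compactl hg (@unit_ball_compact R n).
have cM := homeomorphism_compactl (mpar_homeo M) cMM.
have cN := homeomorphism_compactl (mpar_homeo N) (homeomorphic_compactr M_N cMM).
have mu0 x : (M : set 'rV[R]_m) x -> 0 < rho_mu x.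
  by move=> /L_rho_mu; exact: lt_le_trans.
have nu0 y : (N : set 'rV[R]_p) y -> 0 < rho_nu y.
  by move=> /L_rho_nu; exact: lt_le_trans.
move=> S E c.
have key f (adm : admissible M N f) :=
  stretch_energy_ratio cM cN rho_mu_meas rho_nu_meas mu0 nu0 mu_fin nu_fin adm.
have c_lb e : S e -> (c <= e)%E by move=> [f adm <-]; have [] := key f adm.
split; first by apply: le_ereal_inf_tmp => e; exact: c_lb.
move=> f adm; have [_ <-] := key f adm; split=> [[]//|Ef]; split=> //.
by split; [exists f|move=> e Se; rewrite [E f]Ef; exact: c_lb].
Qed.
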